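(* Let $\Gamma$ be a nonelementary hyperbolic group with Gromov boundary $\partial\Gamma$. Let $G$ be a group with a two-sided invariant metric $\rho$ such that $G$ is complete with respect to $\rho$. Assume that $c\colon\Gamma\times\partial\Gamma\to G$ is a H\''older continuous cocycle, that is, (1) there exist a constant $0<\tau<1$ and, for each $g\in\Gamma$, a positive constant $A_g$ such that $$\rho(c(g,\xi),c(g,\eta))\le A_g\tau^{(\xi|\eta)}\quad\text{for all }\xi,\eta\in\partial\Gamma;$$ (2) the cocycle identity $c(gh,\omega)=c(g,\omega)c(h,g^{-1}\omega)$ holds for all $g,h\in\Gamma$ and $\omega\in\partial\Gamma$. Assume also that $c(g,g^+)=c(g,g^-)=e$ for every infinite order element $g\in\Gamma$. Then there exists a continuous map $b\colon\partial\Gamma\to G$ satisfying $$c(g,\xi)=b(\xi)b(g^{-1}\xi)^{-1}\quad\text{for all }g\in\Gamma,\ \xi\in\partial\Gamma.$$ The map $b$ satisfies H\''older continuity with the same exponent as $c$, that is, there exists a positive constant $A$ such that $$\rho(b(\xi),b(\eta))\le A\tau^{(\xi|\eta)}\quad\text{for all }\xi,\eta\in\partial\Gamma.$$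
   Context: Nonelementary means that $\Gamma$ has no cyclic subgroup of finite index. A finite symmetric generating set $S$ of $\Gamma$ is fixed; $|g|$ is the word length and $d(x,y)=|x^{-1}y|$. The Gromov product is $(x|y)=\frac12(|x|+|y|-d(x,y))$ on $\Gamma$, and for $\xi,\eta\in\partial\Gamma$, $(\xi|\eta)=\sup\liminf_{i,j\to\infty}(x_i|y_j)$, the supremum being over all sequences $\{x_i\}$ in $\Gamma$ converging to $\xi$ and $\{y_j\}$ converging to $\eta$ (so $(\xi|\xi)=\infty$, with $\tau^\infty=0$). For an infinite order element $g\in\Gamma$, $g^+=\lim_{n\to\infty}g^n$ and $g^-=\lim_{n\to\infty}g^{-n}$ are the two (distinct) fixed points of $g$ in $\partial\Gamma$, attracting and repelling respectively. The symbol $e$ denotes the unit element of $G$ in the hypothesis on $c$. *)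

(* Defs.v *)
From HB Require Import structures.
From mathcomp Require Import all_boot all_order all_algebra.
From mathcomp Require Import all_classical all_reals all_analysis.
From mathcomp Require Import lra.

Set Implicit Arguments.
Unset Strict Implicit.
Unset Printing Implicit Defensive.

Import Order.TTheory GRing.Theory Num.Theory.

Local Open Scope classical_set_scope.
Local Open Scope ring_scope.

Record symGenSet (Gam : groupType) := SymGenSet {
  gens : seq Gam ;
  gens_sym : forall s : Gam, s \in gens -> s^-1%g \in gens ;
  gens_gen : forall g : Gam, exists w : seq Gam,
    {subset w <= gens} /\ \big[*%g/1%g]_(s <- w) s = g }.

Definition infinite_order (Gam : groupType) (g : Gam) : Prop :=
  forall n : nat, (0 < n)%N -> (g ^+ n)%g <> 1%g.

(* [f] lists representatives of left cosets of the cyclic subgroup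
   generated by [z]. *)
Definition has_cyclic_finite_index (Gam : groupType) : Prop :=
  exists z : Gam, exists f : seq Gam, forall g : Gam,
    exists2 a : Gam, a \in f &
      exists n : nat, g = (a * z ^+ n)%g \/ g = (a * z ^- n)%g.

Definition nonelementary (Gam : groupType) : Prop :=
  ~ has_cyclic_finite_index Gam.

Section WordMetric.
Variables (Gam : groupType) (S : symGenSet Gam).
Implicit Types x y z g : Gam.

Definition has_word g : pred nat := fun n =>
  `[< exists w : seq Gam, [/\ {subset w <= gens S},
        \big[*%g/1%g]_(s <- w) s = g & size w = n] >].

Lemma has_word_ex g : exists n, has_word g n.
Proof.
have [w [wS wg]] := gens_gen S g.
by exists (size w); apply/asboolP; exists w.
Qed.

Definition word_length g : nat := ex_minn (has_word_ex g).

Definition word_dist x y : nat := word_length (x^-1 * y)%g.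

Lemma word_lengthM x y :
  (word_length (x * y)%g <= word_length x + word_length y)%N.
Proof.
have lenP g : exists w : seq Gam, [/\ {subset w <= gens S},
    \big[*%g/1%g]_(s <- w) s = g & size w = word_length g].
  by rewrite /word_length; case: ex_minnP => n /asboolP.
have [[u [uS ux <-]] [v [vS vy <-]]] := (lenP x, lenP y).
rewrite /word_length; case: ex_minnP => k _; apply.
apply/asboolP; exists (u ++ v); split.
- by move=> s; rewrite mem_cat => /orP[/uS|/vS].
- by rewrite big_cat /= ux vy.
- by rewrite size_cat.
Qed.

Lemma word_distMl g x y : word_dist (g * x)%g (g * y)%g = word_dist x y.
Proof. by rewrite /word_dist invgM -mulgA mulKg. Qed.

End WordMetric.

Section Boundary.
Variables (R : realType) (Gam : groupType) (S : symGenSet Gam).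
Implicit Types (g : Gam) (x y : nat -> Gam).

Definition gromov_prod (a b : Gam) : R :=
  ((word_length S a)%:R + (word_length S b)%:R - (word_dist S a b)%:R) / 2.

(* Gromov's inequality at the base point 1; as the word metric is left
   invariant, the same constant then works at every base point. *)
Definition hyperbolic_group : Prop :=
  exists delta : R, forall a b c : Gam,
    Num.min (gromov_prod a b) (gromov_prod b c) - delta <= gromov_prod a c.

Definition prod_to_infty x y : Prop :=
  gromov_prod (x p.1) (y p.2) @[p --> filter_prod \oo \oo] --> +oo.

Definition boundary_class x : set (nat -> Gam) :=
  [set y | prod_to_infty y y /\ prod_to_infty x y].

(* The Gromov boundary: classes of sequences [x] with
   [lim_{i,j} (x_i | x_j) = oo], where [x] and [y] are equivalent when
   [lim_{i,j} (x_i | y_j) = oo]. *)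
Definition boundary : Type :=
  {A : set (nat -> Gam) | exists x, prod_to_infty x x /\ A = boundary_class x}.

HB.instance Definition _ := gen_eqMixin boundary.
HB.instance Definition _ := gen_choiceMixin boundary.

Definition cvg_boundary x (xi : boundary) : Prop := sval xi x.

Definition bprod (xi eta : boundary) : \bar R :=
  ereal_sup [set limf_einf (fun p : nat * nat =>
                              (gromov_prod (x p.1) (y p.2))%:E)
                           (filter_prod \oo \oo)
            | x in [set x | cvg_boundary x xi]
            & y in [set y | cvg_boundary y eta]].

(* The topology in which the sets [{eta | (xi | eta) > r}] form a
   neighbourhood basis at [xi]; these sets are neighbourhoods of [xi], but not
   necessarily open, when the group is hyperbolic. *)
Definition boundary_open (U : set boundary) : Prop :=
  forall xi, U xi -> exists r : R, [set eta | (r%:E < bprod xi eta)%E] `<=` U.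

Lemma boundary_openT : boundary_open setT.
Proof. by move=> xi _; exists 0. Qed.

Lemma boundary_openI : setI_closed boundary_open.
Proof.
move=> U V Uo Vo xi [/Uo[r rU] /Vo[s sV]].
exists (Num.max r s) => eta /= h; split.
  by apply: rU => /=; apply: le_lt_trans h; rewrite lee_fin le_max lexx.
by apply: sV => /=; apply: le_lt_trans h; rewrite lee_fin le_max lexx orbT.
Qed.

Lemma boundary_open_bigU (I : Type) (f : I -> set boundary) :
  (forall i, boundary_open (f i)) -> boundary_open (\bigcup_i f i).
Proof.
move=> fo xi [i _ /fo[r rf]]; exists r.
by apply: subset_trans rf _ => eta fi; exists i.
Qed.

HB.instance Definition _ := @isOpenTopological.Build boundary
  boundary_open boundary_openT boundary_openI boundary_open_bigU.

Lemma gromov_prodMl g (a b : Gam) :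
  gromov_prod a b - (word_length S g^-1%g)%:R
    <= gromov_prod (g * a)%g (g * b)%g.
Proof.
have h c : (word_length S c)%:R - (word_length S g^-1%g)%:R
    <= (word_length S (g * c)%g)%:R :> R.
  rewrite lerBlDl -natrD ler_nat.
  by have := word_lengthM S g^-1%g (g * c)%g; rewrite mulKg.
rewrite /gromov_prod word_distMl.
by have := h a; have := h b; lra.
Qed.

Lemma prod_to_inftyMl g x y : prod_to_infty x y ->
  prod_to_infty (fun i => (g * x i)%g) (fun i => (g * y i)%g).
Proof.
rewrite /prod_to_infty => /cvgryPge xy; apply/cvgryPge => A.
apply: filterS (xy (A + (word_length S g^-1%g)%:R)) => p.
by rewrite -lerBrDr => /le_trans; apply; exact: gromov_prodMl.
Qed.

Lemma boundary_classMl g x :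
  [set (fun i => (g * y i)%g) | y in boundary_class x]
    = boundary_class (fun i => (g * x i)%g).
Proof.
apply/seteqP; split=> [_ [y [yy xy] <-]|y [yy xy]].
  by split; apply: prod_to_inftyMl.
have K z : (fun i => (g^-1 * (g * z i))%g) = z :> (nat -> Gam).
  by apply/funext => i; rewrite mulKg.
exists (fun i => (g^-1 * y i)%g); last by apply/funext => i; rewrite mulVKg.
split; first exact: prod_to_inftyMl.
by rewrite -[x]K; exact: (prod_to_inftyMl g^-1%g xy).
Qed.

Lemma boundary_act_subproof g (xi : boundary) : exists x,
  prod_to_infty x x /\
  [set (fun i => (g * y i)%g) | y in sval xi] = boundary_class x.
Proof.
have [x [xx ->]] := svalP xi; exists (fun i => (g * x i)%g).
by rewrite boundary_classMl; split=> //; exact: prod_to_inftyMl.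
Qed.

Definition boundary_act g (xi : boundary) : boundary :=
  exist _ [set (fun i => (g * y i)%g) | y in sval xi]
    (boundary_act_subproof g xi).

(* Stated relationally to avoid a junk value of g^+ and g^-: a sequence belongs
   to at most one class, and when [g] has infinite order in a hyperbolic group
   the limits exist.  [xi] is the fixed point g^+ (resp. g^-) of [g]. *)
Definition attracting_point g (xi : boundary) : Prop :=
  cvg_boundary (fun n => (g ^+ n)%g) xi.

Definition repelling_point g (xi : boundary) : Prop :=
  cvg_boundary (fun n => (g ^- n)%g) xi.

End Boundary.

(* [tau ^ u] for [0 < tau < 1], so that [tau ^ oo = 0].  The value at -oo is
   never used: Gromov products are nonnegative. *)
Definition powR_ereal (R : realType) (tau : R) (u : \bar R) : R :=
  match u with
  | r%:E => tau `^ r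
  | +oo%E => 0
  | -oo%E => 0
  end.

(* [Complete] carries a distinguished point, which plays no role here (the
   carrier always contains 1). *)
HB.mixin Record isBiInvariant (R : realType) G
    & monoid.Group G & Metric R G := {
  mdist_mulg : forall g x y : G,
    mdist (g * x)%g (g * y)%g = mdist x y :> R ;
  mdist_mulgr : forall g x y : G,
    mdist (x * g)%g (y * g)%g = mdist x y :> R }.

#[short(type="biInvCompleteGroupType")]
HB.structure Definition BiInvCompleteGroup (R : realType) :=
  {G of monoid.Group G & Metric R G & Complete G & isBiInvariant R G}.

(* Main.v *)
(* If p is loxodromic with fixed points p+ and p-, then p contracts towards p+
   away from p-, and c is trivial at p+; so b(xi) = lim_N c(p^-N, xi) exists for
   xi <> p- and is Hoelder continuous away from p- with the exponent of c.  To see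
   that b is a transfer function, take y in Gamma with y p+ <> p-.  Then y p^N is
   loxodromic for large N, its attracting point z_N tends to y p+, and the
   relation c(y p^N, z_N) = 1 reads c(p^-N, z_N) = c(y, z_N); in the limit,
   b(y p+) = c(y, y p+).  Hence c(g, xi) = b(xi) b(g^-1 xi)^-1 for xi in the orbit
   of p+, and by density whenever xi and g^-1 xi avoid p-.  Finally b extends
   across p- by b(xi) = c(k, xi) b(k^-1 xi), where k is any element moving p-.
   Such elements exist, and so does p, because a hyperbolic group that fixes a
   point at infinity is virtually cyclic. *)
Require Import Defs.
From mathcomp Require Import all_boot all_order all_algebra.
From mathcomp Require Import all_classical all_reals all_analysis.
From mathcomp Require Import ring lra zify.
Import Order.TTheory GRing.Theory Num.Theory.
Local Open Scope classical_set_scope.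
Local Open Scope ring_scope.

Set Implicit Arguments.
Unset Strict Implicit.

(** * Word length and Gromov product *)

Section WordLength.
Variables (Gam : groupType) (S : symGenSet Gam).
Implicit Types g x y : Gam.
Local Notation len := (word_length S).

Lemma word_lengthP g : exists w : seq Gam, [/\ {subset w <= gens S},
  \big[*%g/1%g]_(s <- w) s = g & size w = len g].
Proof. by rewrite /word_length; case: ex_minnP => n /asboolP. Qed.

Lemma word_length_le (w : seq Gam) : {subset w <= gens S} ->
  (len (\big[*%g/1%g]_(s <- w) s) <= size w)%N.
Proof.
move=> wS; rewrite /word_length; case: ex_minnP => k _; apply.
by apply/asboolP; exists w.
Qed.

Lemma word_length1 : len 1%g = 0%N.
Proof.
by have := @word_length_le [::]; rewrite big_nil leqn0 => /(_ _)/eqP; apply.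
Qed.

Lemma word_length0 g : len g = 0%N -> g = 1%g.
Proof.
have [w [_ <- <-]] := word_lengthP g => /size0nil ->; exact: big_nil.
Qed.

Lemma prodVg_rev (w : seq Gam) :
  \big[*%g/1%g]_(s <- rev [seq s^-1%g | s <- w]) s
    = (\big[*%g/1%g]_(s <- w) s)^-1%g.
Proof.
elim: w => [|s w IH]; first by rewrite !big_nil invg1.
by rewrite /= rev_cons -cats1 big_cat big_seq1 IH big_cons invgM.
Qed.

Lemma word_lengthV g : len g^-1%g = len g.
Proof.
suff le h : (len h^-1%g <= len h)%N.
  by apply/eqP; rewrite eqn_leq le /= -{1}[g]invgK le.
have [w [wS <- <-]] := word_lengthP h.
rewrite -prodVg_rev -(size_map (fun s => s^-1%g) w) -size_rev word_length_le //.
by move=> s; rewrite mem_rev => /mapP[t /wS tS ->]; exact: gens_sym.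
Qed.

Lemma word_distC x y : word_dist S x y = word_dist S y x.
Proof. by rewrite /word_dist -word_lengthV invgM invgK. Qed.

Lemma finite_word_ball n :
  exists f : seq Gam, forall g, (len g <= n)%N -> g \in f.
Proof.
elim: n => [|n [f fP]].
  exists [:: 1%g] => g; rewrite leqn0 => /eqP/word_length0 ->.
  by rewrite mem_seq1.
exists (f ++ [seq (s * h)%g | s <- gens S, h <- f]) => g gn.
have [w [wS wg ws]] := word_lengthP g.
case: w wS wg ws => [|s w] wS wg ws.
  by rewrite mem_cat fP // -ws.
rewrite mem_cat; apply/orP; right; apply/allpairsP.
exists (s, \big[*%g/1%g]_(t <- w) t); split => /=.
- by apply: wS; rewrite mem_head.
- apply: fP; have wS' : {subset w <= gens S}.
    by move=> t tw; apply: wS; rewrite in_cons tw orbT.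
  by rewrite (leq_trans (word_length_le wS'))// -ltnS; move: ws gn => /= <-.
- by rewrite -wg big_cons.
Qed.

(** Cut a shortest word for [g] after [t] letters: the pieces have length at most [t] and
    [len g - t], and subadditivity forces equality. *)
Lemma word_geodesic g t : (t <= len g)%N ->
  exists w, len w = t /\ len (w^-1 * g)%g = (len g - t)%N.
Proof.
move=> tg; have [w [wS wg ws]] := word_lengthP g.
pose u := \big[*%g/1%g]_(s <- take t w) s.
pose v := \big[*%g/1%g]_(s <- drop t w) s.
have uv : (u * v)%g = g by rewrite -wg -[w in RHS](cat_take_drop t) big_cat.
have ut : (len u <= t)%N.
  apply: leq_trans (word_length_le _) _; last by rewrite size_take_min geq_minl.
  by move=> s /mem_take/wS.
have vt : (len v <= len g - t)%N.
  apply: leq_trans (word_length_le _) _; last by rewrite size_drop ws.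
  by move=> s /mem_drop/wS.
exists u; rewrite -uv mulKg uv.
have := word_lengthM S u v; rewrite uv; lia.
Qed.

End WordLength.

Section GromovProduct.
Variables (R : realType) (Gam : groupType) (S : symGenSet Gam).
Implicit Types a b g x y : Gam.
Local Notation len g := ((word_length S g)%:R : R).
Local Notation gp := (gromov_prod R S).

(** The product [gp x g^-1] is half the length lost to cancellation in [g * x]. *)
Lemma word_lengthM_gp g x : len (g * x)%g = len x + len g - 2 * gp x g^-1%g.
Proof.
rewrite /gromov_prod /word_dist -invgM !word_lengthV; lra.
Qed.

Lemma gromov_prodC x y : gp x y = gp y x.
Proof. by rewrite /gromov_prod word_distC (addrC (len x)). Qed.

Lemma gromov_prod_ge0 x y : 0 <= gp x y.
Proof.
have := word_lengthM S x^-1%g y; rewrite -/(word_dist S x y) word_lengthV.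
by rewrite -(ler_nat R) natrD /gromov_prod; lra.
Qed.

Lemma gromov_prod_lel x y : gp x y <= len x.
Proof.
have := word_lengthM S x (x^-1 * y)%g; rewrite mulVKg -/(word_dist S x y).
by rewrite -(ler_nat R) natrD /gromov_prod; lra.
Qed.

Lemma gromov_prod_ler x y : gp x y <= len y.
Proof. by rewrite gromov_prodC gromov_prod_lel. Qed.

Lemma gromov_prodxx x : gp x x = len x.
Proof. by rewrite /gromov_prod /word_dist mulVg word_length1; lra. Qed.

Lemma gromov_prod1 x : gp x 1%g = 0.
Proof.
by apply/le_anti; rewrite gromov_prod_ge0 (le_trans (gromov_prod_ler _ _))
  ?word_length1.
Qed.

(** Change of base point: the left side is the product of [x] and [y] based at [g^-1]. *)
Lemma gromov_prodM g x y :
  gp (g * x)%g (g * y)%g = gp x y + len g - gp x g^-1%g - gp y g^-1%g.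
Proof.
rewrite {1}/gromov_prod word_distMl (word_lengthM_gp g x) (word_lengthM_gp g y).
by rewrite [gp x y in RHS]/gromov_prod; lra.
Qed.

End GromovProduct.

(** * Consequences of the four-point inequality *)

Section GromovHyperbolic.
Variables (R : realType) (Gam : groupType) (S : symGenSet Gam).
Local Notation len g := ((word_length S g)%:R : R).
Local Notation gp := (gromov_prod R S).
Variable delta : R.
Hypothesis hyp : forall a b c : Gam,
  Num.min (gp a b) (gp b c) - delta <= gp a c.
Implicit Types a b g x y : Gam.

Lemma gromov_hyp b a c r : r <= gp a b -> r <= gp b c -> r - delta <= gp a c.
Proof.
move=> ab bc; apply: le_trans (hyp a b c).
by rewrite lerD2r le_min ab bc.
Qed.

(** Form of the inequality that transfers upper bounds: when [gp a c] is small, [b] cannot be close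
    to both [a] and [c]. *)
Lemma gromov_hyp_or b a c :
  gp a b <= gp a c + delta \/ gp b c <= gp a c + delta.
Proof.
have [h|h] := leP (gp a b) (gp b c).
  by left; rewrite -lerBlDr; exact: (gromov_hyp (lexx _) h).
by right; rewrite -lerBlDr; exact: (gromov_hyp (ltW h) (lexx _)).
Qed.

Lemma delta_ge0 : 0 <= delta.
Proof.
have h : 0 <= gp 1%g 1%g by rewrite gromov_prod1.
by have := gromov_hyp h h; rewrite gromov_prod1; lra.
Qed.

(* Far out, [w] lies on a geodesic towards [v], and so does [g w] up to a
   bounded error as [g v] stays close to [v]; hence they differ by the Busemann
   shift of [g]. *)
Lemma conj_length_le g v w (t : R) : len w = t -> len (w^-1 * v)%g = len v - t ->
  len g <= t -> t <= gp (g^-1 * v)%g v ->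
  len (w^-1 * (g * w))%g
    <= `|len (g^-1 * v)%g - len v| + 6 * delta.
Proof.
move=> lw lwv lg gv; have d0 := delta_ge0.
have wv : gp w v = t by rewrite /gromov_prod /word_dist lwv lw; lra.
have lvg := word_lengthM_gp R S g v.
have lvg' := word_lengthM_gp R S g^-1%g v; rewrite invgK word_lengthV in lvg'.
have lgw := word_lengthM_gp R S g w.
have lw' : len (w^-1 * (g * w))%g = t + len (g * w)%g - 2 * gp w (g * w)%g.
  by rewrite /gromov_prod /word_dist lw; lra.
have vg1 : gp w g^-1%g >= gp v g^-1%g - delta.
  apply: (@gromov_hyp v); rewrite ?wv //.
  by apply: le_trans lg; rewrite -(word_lengthV S g) gromov_prod_ler.
have vg2 : gp v g^-1%g >= len g - gp v g - delta.
  have E := gromov_prodM R S g^-1%g v 1%g.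
  rewrite mulg1 invgK word_lengthV gromov_prod1 (gromov_prodC _ _ 1%g) in E.
  rewrite gromov_prod1 in E.
  apply: (@gromov_hyp (g^-1 * v)%g); last by rewrite E; lra.
  rewrite (gromov_prodC _ _ v (g^-1 * v)%g) (le_trans _ gv)// (le_trans _ lg)//.
  by have := gromov_prod_ge0 R S v g; lra.
have dgw : len (w^-1 * (g^-1 * v))%g <= len v - t
    + (len (g^-1 * v)%g - len v) + 2 * delta.
  have : gp w (g^-1 * v)%g >= t - delta.
    by apply: (@gromov_hyp v); rewrite ?wv // gromov_prodC.
  by rewrite {1}/gromov_prod /word_dist lw; lra.
have gwv : gp (g * w)%g v
   = (len (g * w)%g + len v - len (w^-1 * (g^-1 * v))%g) / 2.
  by rewrite /gromov_prod /word_dist invgM mulgA.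
have n1 := ler_norm (len (g^-1 * v)%g - len v).
have n2 := lerNnormlW (lexx `|len (g^-1 * v)%g - len v|).
(* Either alternative bounds [gp w (g * w)] from below, which by [lw'] bounds the distance from [w]
   to [g * w] from above. *)
have [h|h] := gromov_hyp_or v w (g * w)%g.
- by rewrite wv in h; lra.
- by rewrite gromov_prodC gwv in h; lra.
Qed.

End GromovHyperbolic.

(** * Busemann quasimorphisms *)

(** Descent on the bound: an ultrafilter contains the top level set of [h] or its complement. *)
Lemma ultra_nat_bounded (T : Type) (U : set_system T) (h : T -> nat) N :
  UltraFilter U -> U [set n | (h n < N)%N] -> exists k, U [set n | h n = k].
Proof.
move=> UU; elim: N => [|N IH] UN.
  have : U set0 by apply: filterS UN => n /=; rewrite ltn0.
  by move/filter_not_empty.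
have [?|UC] := in_ultra_setVsetC [set n | h n = N] UU; first by exists N.
apply: IH; apply: filterS2 UN UC => n /= hN /eqP hn.
by rewrite ltn_neqAle hn -ltnS.
Qed.

Lemma near_seq_forall (I : eqType) (T : Type) (F : set_system T)
    (s : seq I) (P : I -> T -> Prop) : Filter F ->
  (forall i, i \in s -> \forall x \near F, P i x) ->
  \forall x \near F, forall i, i \in s -> P i x.
Proof.
move=> FF; elim: s => [|j s IH] sP; first by apply: nearW => x i; rewrite in_nil.
have sP' : \forall x \near F, forall i, i \in s -> P i x.
  by apply: IH => i si; apply: sP; rewrite in_cons si orbT.
have jP : \forall x \near F, P j x by apply: sP; rewrite mem_head.
by apply: filterS2 sP' jP => x sx jx i; rewrite in_cons => /predU1P[->|/sx].
Qed.

(** Otherwise every list misses some element of [P], and adjoining such elements one at a time gives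
    [M + 1] distinct ones. *)
Lemma uniq_bounded_enum (T : choiceType) (P : T -> Prop) M :
  (forall s : seq T, uniq s -> (forall x, x \in s -> P x) -> (size s <= M)%N) ->
  exists f : seq T, forall x, P x -> x \in f.
Proof.
move=> sM; apply: contrapT => nf.
suff [s [us sP sz]] : exists s : seq T,
    [/\ uniq s, forall x, x \in s -> P x & size s = M.+1].
  by have := sM s us sP; rewrite sz ltnn.
elim: M.+1 => [|n [s [us sP sz]]]; first by exists [::].
have [x /not_implyP[Px /negP xs]] : exists x, ~ (P x -> x \in s).
  by apply/existsNP => sall; apply: nf; exists s.
exists (x :: s); split; rewrite /= ?xs ?sz //.
by move=> y; rewrite in_cons => /predU1P[->|/sP].
Qed.

Section QuasiFixed.
Variables (R : realType) (Gam : groupType) (S : symGenSet Gam).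
Local Notation len g := ((word_length S g)%:R : R).
Local Notation gp := (gromov_prod R S).
Variable delta : R.
Hypothesis hyp : forall a b c : Gam,
  Num.min (gp a b) (gp b c) - delta <= gp a c.
Implicit Types a b g x y z : Gam.

(* The powers of any element with a large value are coarsely dense. *)
Lemma cyclic_of_proper_quasimorphism (beta : Gam -> R) (C : R) :
  (forall g h, `|beta (g * h)%g - beta g - beta h| <= C) ->
  (forall K, exists f : seq Gam, forall g, `|beta g| <= K -> g \in f) ->
  has_cyclic_finite_index Gam.
Proof.
move=> qm prop; have C0 : 0 <= C := le_trans (normr_ge0 _) (qm 1%g 1%g).
have [[z zC]|nz] := pselect (exists z, C + 1 < `|beta z|); last first.
  (* Here [beta] is bounded, so by properness the group is finite and the trivial subgroup has
     finite index. *)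
  have [f fP] := prop (C + 1).
  exists 1%g, f => g; exists g.
    by apply: fP; rewrite leNgt; apply/negP => h; apply: nz; exists g.
  by exists 0%N; left; rewrite expg0 mulg1.
have [f fP] := prop (`|beta z| + C); exists z, f => g.
have [m] : exists m : nat, `|beta g| <= m%:R.
  exists (Num.truncn `|beta g|).+1; exact/ltW/truncnS_gt.
elim: m g => [|m IH] g gm.
  exists g; first by apply: fP; apply: le_trans gm _; apply: addr_ge0.
  by exists 0%N; left; rewrite expg0 mulg1.
have [gK|gK] := leP `|beta g| (`|beta z| + C).
  exists g; first exact: fP.
  by exists 0%N; left; rewrite expg0 mulg1.
(* Multiplying by [z] or [z^-1], according to the signs of [beta g] and [beta z], moves [beta g]
   towards 0 by more than [C + 1], up to an error [C]; its size drops by at least 1. *)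
have [same|diff] : `|beta (g * z^-1)%g| <= m%:R \/ `|beta (g * z)%g| <= m%:R.
  have := qm (g * z^-1)%g z; rewrite mulgVK; have := qm g z.
  rewrite -natr1 in gm; move: zC gK gm.
  rewrite !ler_norml => zC gK gm.
  case: (lerP 0 (beta z)) zC gK => z0; rewrite ?(ger0_norm z0) ?(ltr0_norm z0);
  case: (lerP 0 (beta g)) gm => g0; rewrite ?(ger0_norm g0) ?(ltr0_norm g0);
    move=> gm zC gK h1 h2.
  - by left; apply/andP; split; lra.
  - by right; apply/andP; split; lra.
  - by right; apply/andP; split; lra.
  - by left; apply/andP; split; lra.
- have [a fa [n [/esym E|/esym E]]] := IH _ same; exists a => //.
    by exists n.+1; left; rewrite expgSr mulgA E mulgVK.
  case: n E => [|n] E.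
    by exists 1%N; left; rewrite -(mulgVK z g) -E expg0 invg1 mulg1 expg1.
  exists n; right; rewrite -(mulgVK z g) -E expgS invgM -!mulgA mulVg mulg1 //.
- have [a fa [n [/esym E|/esym E]]] := IH _ diff; exists a => //.
    case: n E => [|n] E.
      by exists 1%N; right; rewrite -(mulgK z g) -E expg0 mulg1 expg1.
    by exists n; left; rewrite -(mulgK z g) -E expgSr -!mulgA mulgV mulg1.
  by exists n.+1; right; rewrite expgS invgM mulgA E mulgK.
Qed.

(* If [v n] "converges to a point at infinity fixed by the whole group", its
   Busemann function along an ultrafilter is a proper quasimorphism. *)
Lemma elementary_of_quasi_fixed (v : nat -> Gam) :
  (forall g (A : R), \forall n \near \oo, A <= gp (g * v n)%g (v n)) ->
  has_cyclic_finite_index Gam.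
Proof.
move=> vfix; have d0 := delta_ge0 hyp.
have [U [UU oU]] := ultraFilterLemma (F := \oo : set_system nat) _.
have UF : ProperFilter U by apply: ultra_proper.
pose bt n g := len (g^-1 * v n)%g - len (v n).
have /boolp.choice[beta betaE] : forall g, exists l : R, U [set n | bt n g = l].
  move=> g.
  (* Lengths are integers: shifted by the length of [g], the difference is a natural number at most
     twice that length, hence constant on a set of [U]. *)
  pose h n := (word_length S (g^-1 * v n)%g + word_length S g
                 - word_length S (v n))%N.
  have le1 n : (word_length S (v n)
      <= word_length S (g^-1 * v n)%g + word_length S g)%N.
    by have := word_lengthM S g (g^-1 * v n)%g; rewrite mulVKg addnC.
  have [|k Uk] := @ultra_nat_bounded _ U h (2 * word_length S g).+1 UU.
    apply: filterE => n /=; rewrite /h.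
    rewrite ltnS leq_subLR mul2n -addnn addnA leq_add2r addnC.
    by have := word_lengthM S g^-1%g (v n); rewrite word_lengthV.
  exists (k%:R - len g); apply: filterS Uk => n /= <-.
  by rewrite /bt /h natrB // natrD; lra.
have near_beta g : \forall n \near U, bt n g = beta g by exact: betaE.
apply: (@cyclic_of_proper_quasimorphism beta (2 * delta)).
- move=> g h; near U => n.
  have <- : bt n g = beta g by near: n.
  have <- : bt n h = beta h by near: n.
  have <- : bt n (g * h)%g = beta (g * h)%g by near: n.
  have vn : len h <= gp (g^-1 * v n)%g (v n) by near: n; apply/oU/vfix.
  rewrite /bt invgM -mulgA.
  rewrite (word_lengthM_gp R S h^-1%g (g^-1 * v n)%g).
  rewrite (word_lengthM_gp R S h^-1%g (v n)) invgK.
  (* Up to sign the defect of [beta] is twice [gp (v n) h - gp (g^-1 * v n) h]. The two points agree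
     beyond the length of [h], so these products differ by at most [delta]. *)
  have h1 : gp (v n) h <= gp (g^-1 * v n)%g h + delta.
    rewrite -lerBlDr; apply: (gromov_hyp hyp (b := v n)) => //.
    exact: le_trans (gromov_prod_ler _ _ _ _) vn.
  have h2 : gp (g^-1 * v n)%g h <= gp (v n) h + delta.
    rewrite -lerBlDr; apply: (gromov_hyp hyp (b := (g^-1 * v n)%g)) => //.
    rewrite [X in _ <= X]gromov_prodC.
    exact: le_trans (gromov_prod_ler _ _ _ _) vn.
  by rewrite ler_norml; apply/andP; split; lra.
- move=> K.
  (* The size of this ball bounds every finite set on which [beta] is at most [K] in size:
     conjugation by a prefix [w] of some [v n] embeds the set into the ball, whose radius does not
     depend on the set. *)
  have [f fP] := finite_word_ball S (Num.truncn (K + 6 * delta)).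
  apply: (@uniq_bounded_enum _ _ (size f)) => s us sK.
  pose t := \max_(g <- s) word_length S g.
  near U => n.
  have sn : forall g, g \in s ->
      bt n g = beta g /\ t%:R <= gp (g^-1 * v n)%g (v n).
    near: n; apply: near_seq_forall => g _.
    by apply: filterI; [exact: near_beta | apply/oU/vfix].
  have tv : (t <= word_length S (v n))%N.
    rewrite -(ler_nat R) -gromov_prodxx -{1}(mul1g (v n)).
    by near: n; apply/oU/vfix.
  have [w [wt wv]] := word_geodesic tv.
  rewrite -(size_map (fun g => w^-1 * (g * w))%g s); apply: uniq_leq_size.
    by rewrite map_inj_uniq // => x y /mulgI/mulIg.
  move=> _ /mapP[g gs ->]; apply: fP.
  have [gn gt] := sn _ gs; rewrite truncn_ge_nat.
    apply: le_trans (conj_length_le hyp (v := v n) (t := t%:R) _ _ _ gt) _.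
    - by rewrite wt.
    - by rewrite wv natrB.
    - by rewrite ler_nat /t; exact: leq_bigmax_seq.
    - by rewrite lerD2r -/(bt n g) gn sK.
  apply: addr_ge0; first exact: le_trans (normr_ge0 _) (sK _ gs).
  by rewrite mulr_ge0.
Unshelve. all: by end_near. Qed.

End QuasiFixed.

(** * The Gromov boundary *)

Lemma near_prod_nat (P : nat * nat -> Prop) :
  (\forall p \near filter_prod \oo \oo, P p) <->
  exists N, forall i j, (N <= i)%N -> (N <= j)%N -> P (i, j).
Proof.
split=> [[[A B] /= [[n _ nA] [m _ mB]] AB]|[N NP]].
  exists (maxn n m) => i j; rewrite !geq_max => /andP[ni _] /andP[_ mj].
  by apply: AB; split => /=; [exact: nA | exact: mB].
exists ([set i | (N <= i)%N], [set i | (N <= i)%N]) => /=.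
  by split; exists N.
by move=> [i j] [/= Ni Nj]; exact: NP.
Qed.

Section BoundarySequences.
Variables (R : realType) (Gam : groupType) (S : symGenSet Gam).
Local Notation len g := ((word_length S g)%:R : R).
Local Notation gp := (gromov_prod R S).
Local Notation bd := (boundary R S).
Implicit Types (x y z : nat -> Gam) (r s : R) (xi eta zeta : bd) (g h : Gam).

Definition eventually_ge r x y : Prop :=
  exists N, forall i j, (N <= i)%N -> (N <= j)%N -> r <= gp (x i) (y j).

Lemma eventually_geC r x y : eventually_ge r x y -> eventually_ge r y x.
Proof. by move=> [N h]; exists N => i j Ni Nj; rewrite gromov_prodC h. Qed.

Lemma prod_to_inftyP x y :
  prod_to_infty R S x y <-> forall r, eventually_ge r x y.
Proof.
rewrite /prod_to_infty cvgryPge; split=> h r; first by have /near_prod_nat := h r.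
by apply/near_prod_nat; exact: h.
Qed.

Lemma prod_to_inftyC x y : prod_to_infty R S x y -> prod_to_infty R S y x.
Proof.
move=> /prod_to_inftyP h; apply/prod_to_inftyP => r.
exact/eventually_geC/h.
Qed.

Lemma cvg_boundary_ex xi : exists x, cvg_boundary x xi.
Proof.
case: xi => A [x [xx AE]]; exists x; rewrite /cvg_boundary /= AE.
by split.
Qed.

Lemma boundary_of_seq x : prod_to_infty R S x x ->
  exists xi : bd, cvg_boundary x xi.
Proof.
move=> xx; have ex : exists y, prod_to_infty R S y y
  /\ boundary_class R S x = boundary_class R S y by exists x.
by exists (exist (fun A => exists y, prod_to_infty R S y y
  /\ A = boundary_class R S y) _ ex).
Qed.

Lemma cvg_boundary_self x xi : cvg_boundary x xi -> prod_to_infty R S x x.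
Proof. by case: xi => A [y [yy AE]]; rewrite /cvg_boundary /= AE => -[]. Qed.

Lemma boundary_eq xi eta : sval xi = sval eta -> xi = eta.
Proof. by case: xi eta => [A ?] [B ?] /= AB; exact: eq_exist. Qed.

Lemma cvg_boundary_act g x xi : cvg_boundary x xi ->
  cvg_boundary (fun i => g * x i)%g (boundary_act g xi).
Proof. by move=> xxi; exists x. Qed.

Lemma boundary_act1 xi : boundary_act 1%g xi = xi.
Proof.
have mul1 x : (fun i => 1 * x i)%g = x by apply/funext => i; rewrite mul1g.
apply: boundary_eq => /=; apply/seteqP; split=> [_ [x xxi <-]|x xxi].
  by rewrite mul1.
by exists x; rewrite ?mul1.
Qed.

Lemma boundary_actM g h xi :
  boundary_act (g * h)%g xi = boundary_act g (boundary_act h xi).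
Proof.
apply: boundary_eq => /=; apply/seteqP; split=> [_ [x xxi <-]|_ [_ [x xxi <-] <-]].
  exists (fun i => h * x i)%g; first by exists x.
  by apply/funext => i; rewrite mulgA.
by exists x => //; apply/funext => i; rewrite mulgA.
Qed.

Lemma boundary_actK g xi : boundary_act g^-1%g (boundary_act g xi) = xi.
Proof. by rewrite -boundary_actM mulVg boundary_act1. Qed.

Lemma boundary_actVK g xi : boundary_act g (boundary_act g^-1%g xi) = xi.
Proof. by rewrite -boundary_actM mulgV boundary_act1. Qed.

Lemma eventually_ge_bprod r x y xi eta :
  cvg_boundary x xi -> cvg_boundary y eta -> eventually_ge r x y ->
  (r%:E <= bprod xi eta)%E.
Proof.
move=> xxi yeta [N xy]; apply: le_ereal_sup_tmp.
exists (limf_einf (fun p : nat * nat => (gp (x p.1) (y p.2))%:E)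
  (filter_prod \oo \oo)); first by exists x => //; exists y.
rewrite limf_einfE; apply: le_ereal_sup_tmp.
exists (ereal_inf ((fun p : nat * nat => (gp (x p.1) (y p.2))%:E)
   @` [set p | (N <= p.1)%N /\ (N <= p.2)%N])).
  exists [set p | (N <= p.1)%N /\ (N <= p.2)%N] => //.
  by apply/near_prod_nat; exists N.
apply: le_ereal_inf_tmp => _ [[i j] /= [Ni Nj] <-].
by rewrite lee_fin xy.
Qed.

Lemma lt_limf_einf_eventually_ge r x y :
  (r%:E < limf_einf (fun p : nat * nat => (gp (x p.1) (y p.2))%:E)
     (filter_prod \oo \oo))%E -> eventually_ge r x y.
Proof.
rewrite limf_einfE => /ereal_sup_gt[_ [V /near_prod_nat[N VN] <-] rV].
exists N => i j Ni Nj; rewrite -lee_fin; apply: le_trans (ltW rV) _.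
by apply: ereal_inf_lbound; exists (i, j) => //; exact: VN.
Qed.

Lemma bprod_ge0 xi eta : (0 <= bprod xi eta)%E.
Proof.
have [[x xxi] [y yeta]] := (cvg_boundary_ex xi, cvg_boundary_ex eta).
apply: eventually_ge_bprod xxi yeta _.
by exists 0%N => i j _ _; exact: gromov_prod_ge0.
Qed.

(* Comparing all pairs of representing sequences, instead of a single one, loses
   no additive constant. *)
Lemma bprod_shift s xi eta xi' eta' :
  (forall x y, cvg_boundary x xi -> cvg_boundary y eta ->
    exists x' y', [/\ cvg_boundary x' xi', cvg_boundary y' eta' &
      forall r, eventually_ge r x y -> eventually_ge (r + s) x' y']) ->
  (bprod xi eta + s%:E <= bprod xi' eta')%E.
Proof.
move=> sh; rewrite -leeBrDr //.
apply: ge_ereal_sup => _ [x xxi [y yeta <-]].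
rewrite limf_einfE; apply: ge_ereal_sup => _ [V /near_prod_nat[N VN] <-].
have [x' [y' [xxi' yeta' xyr]]] := sh x y xxi yeta.
set f := fun p : nat * nat => _.
have fV i j : (N <= i)%N -> (N <= j)%N -> (ereal_inf (f @` V) <= (gp (x i) (y j))%:E)%E.
  by move=> Ni Nj; apply: ereal_inf_lbound; exists (i, j) => //; exact: VN.
case: (ereal_inf _) fV => [m| |] fV; rewrite ?leNye //; last first.
  by have := fV N N (leqnn _) (leqnn _); rewrite leye_eq.
rewrite leeBrDr // -EFinD; apply: (eventually_ge_bprod xxi' yeta'); apply: xyr.
by exists N => i j Ni Nj; rewrite -lee_fin fV.
Qed.

Lemma bprodC xi eta : bprod xi eta = bprod eta xi.
Proof.
have le (a b : bd) : (bprod a b <= bprod b a)%E; last by apply/le_anti; rewrite !le.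
have := @bprod_shift 0 a b b a; rewrite adde0; apply => x y xa yb.
by exists y, x; split => // r; rewrite addr0; exact: eventually_geC.
Qed.

Lemma bprod_act g xi eta :
  (bprod xi eta + (- len g)%:E <= bprod (boundary_act g xi) (boundary_act g eta))%E.
Proof.
apply: bprod_shift => x y xxi yeta.
exists (fun i => g * x i)%g, (fun i => g * y i)%g; split.
- exact: cvg_boundary_act.
- exact: cvg_boundary_act.
- move=> r [N NP]; exists N => i j Ni Nj; rewrite -(word_lengthV S g).
  by apply: le_trans (gromov_prodMl _ _ _ _ _); rewrite lerD2r NP.
Qed.

End BoundarySequences.

(** * The boundary of a hyperbolic group *)

Section HyperbolicBoundary.
Variables (R : realType) (Gam : groupType) (S : symGenSet Gam).
Local Notation len g := ((word_length S g)%:R : R).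
Local Notation gp := (gromov_prod R S).
Local Notation bd := (boundary R S).
Local Notation ev := (@eventually_ge R Gam S).
Variable delta : R.
Hypothesis hyp : forall a b c : Gam,
  Num.min (gp a b) (gp b c) - delta <= gp a c.
Implicit Types (x y z : nat -> Gam) (r s : R) (xi eta zeta : bd) (g h p q : Gam).

Lemma eventually_ge_trans r x y z : ev r x y -> ev r y z -> ev (r - delta) x z.
Proof.
move=> [N xy] [M yz]; exists (maxn N M) => i j.
rewrite !geq_max => /andP[Ni Mi] /andP[Nj Mj].
by apply: (gromov_hyp hyp (b := y j)); [exact: xy | exact: yz].
Qed.

Lemma prod_to_infty_trans x y z :
  prod_to_infty R S x y -> prod_to_infty R S y z -> prod_to_infty R S x z.
Proof.
move=> /prod_to_inftyP xy /prod_to_inftyP yz; apply/prod_to_inftyP => r.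
by rewrite -(addrK delta r); apply: eventually_ge_trans.
Qed.

Lemma cvg_boundary_equiv x y xi :
  cvg_boundary x xi -> cvg_boundary y xi -> prod_to_infty R S x y.
Proof.
case: xi => A [z [zz AE]]; rewrite /cvg_boundary /= AE => -[xx zx] [yy zy].
exact: prod_to_infty_trans (prod_to_inftyC zx) zy.
Qed.

Lemma cvg_boundary_trans x y xi : cvg_boundary x xi ->
  prod_to_infty R S x y -> cvg_boundary y xi.
Proof.
case: xi => A [z [zz AE]]; rewrite /cvg_boundary /= AE => -[xx zx] xy.
split; last exact: prod_to_infty_trans xy.
exact: prod_to_infty_trans (prod_to_inftyC xy) xy.
Qed.

Lemma cvg_boundary_unique x xi eta :
  cvg_boundary x xi -> cvg_boundary x eta -> xi = eta.
Proof.
move=> xxi xeta; apply: boundary_eq; apply/seteqP; split=> y yh.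
  exact: cvg_boundary_trans xeta (cvg_boundary_equiv xxi yh).
exact: cvg_boundary_trans xxi (cvg_boundary_equiv xeta yh).
Qed.

(** Sequences nearly attaining the supremum are replaced by the given ones at a cost of [delta] on
    each side. *)
Lemma bprod_gt_eventually_ge r x y xi eta :
  cvg_boundary x xi -> cvg_boundary y eta -> (r%:E < bprod xi eta)%E ->
  ev (r - 2 * delta) x y.
Proof.
move=> xxi yeta /ereal_sup_gt[_ [x' x'xi [y' y'eta <-]]].
move=> /lt_limf_einf_eventually_ge x'y'.
have /prod_to_inftyP xx' := cvg_boundary_equiv xxi x'xi.
have /prod_to_inftyP y'y := cvg_boundary_equiv y'eta yeta.
have d0 := delta_ge0 hyp.
have -> : r - 2 * delta = r - delta - delta by lra.
apply: eventually_ge_trans (y'y _).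
exact: eventually_ge_trans (xx' _) x'y'.
Qed.

(** If one late pair exceeded the bound, then, as each sequence has large products with itself, all
    late pairs would have product at least [r + 1], against the supremum. *)
Lemma bprod_le_eventually_le r x y xi eta :
  cvg_boundary x xi -> cvg_boundary y eta -> (bprod xi eta <= r%:E)%E ->
  exists N, forall i j, (N <= i)%N -> (N <= j)%N ->
    gp (x i) (y j) <= r + 1 + 2 * delta.
Proof.
move=> xxi yeta xir; pose s := r + 1 + 2 * delta.
have /prod_to_inftyP/(_ s)[N xx] := cvg_boundary_self xxi.
have /prod_to_inftyP/(_ s)[M yy] := cvg_boundary_self yeta.
exists (maxn N M) => i j; rewrite !geq_max => /andP[Ni Mi] /andP[Nj Mj].
rewrite leNgt; apply/negP => lt_s.
have : (bprod xi eta < (r + 1)%:E)%E.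
  by rewrite (le_lt_trans xir)// lte_fin ltrDl.
apply/negP; rewrite -leNgt; apply: eventually_ge_bprod xxi yeta _.
exists (maxn N M) => k l; rewrite !geq_max => /andP[Nk Mk] /andP[Nl Ml].
have -> : r + 1 = s - delta - delta by rewrite /s; lra.
apply: (gromov_hyp hyp (b := y j)); last first.
  by have := delta_ge0 hyp; have := yy j l Mj Ml; lra.
apply: (gromov_hyp hyp (b := x i)); first exact: xx.
exact: ltW.
Qed.

(** The loss is [2 * delta] for passing to representing sequences and [delta] for the inequality
    between them. *)
Lemma bprod_hyp r xi eta zeta : (r%:E < bprod xi eta)%E ->
  (r%:E < bprod eta zeta)%E -> ((r - 3 * delta)%:E <= bprod xi zeta)%E.
Proof.
move=> r1 r2.
have [[x xxi] [[y yeta] [z zzeta]]] :=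
  (cvg_boundary_ex xi, (cvg_boundary_ex eta, cvg_boundary_ex zeta)).
have := eventually_ge_trans (bprod_gt_eventually_ge xxi yeta r1)
  (bprod_gt_eventually_ge yeta zzeta r2).
have -> : r - 2 * delta - delta = r - 3 * delta by lra.
exact: eventually_ge_bprod.
Qed.

(** * Powers of elements with little backtracking *)

Section Reduced.
Variables (g : Gam) (a : R).
Hypothesis (ga : gp g^-1%g g <= a) (lg : 2 * a + 3 * delta < len g).

Let a0 : 0 <= a := le_trans (gromov_prod_ge0 R S _ _) ga.
Let d0 : 0 <= delta := delta_ge0 hyp.

(** Induction: little cancellation in [g * g ^+ n] makes [g ^+ n.+1] start like [g], which is apart
    from [g^-1]. The loss [delta] does not accumulate, since each step compares with [g] itself. *)
Lemma reduced_gp_inv n : gp g^-1%g (g ^+ n)%g <= a + delta.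
Proof.
elim: n => [|n IH]; first by rewrite expg0 gromov_prod1 addr_ge0.
have ln := word_lengthM_gp R S g (g ^+ n)%g; rewrite -expgS gromov_prodC in ln.
have lgn : gp (g ^+ n.+1)%g g = (len (g ^+ n.+1)%g + len g - len (g ^+ n)%g) / 2.
  by rewrite gromov_prodC /gromov_prod /word_dist expgS mulKg; lra.
have h0 := d0; have h1 := lg; have h2 := ga.
have [h|h] := gromov_hyp_or hyp (g ^+ n.+1)%g g^-1%g g; lra.
Qed.

Lemma reduced_len n : len (g ^+ n)%g + (len g - 2 * a - 2 * delta)
  <= len (g ^+ n.+1)%g.
Proof.
have ln := word_lengthM_gp R S g (g ^+ n)%g; rewrite -expgS gromov_prodC in ln.
by have := reduced_gp_inv n; lra.
Qed.

Lemma reduced_gp_self n : len g - a - delta <= gp (g ^+ n.+1)%g g.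
Proof.
have := reduced_len n.
by rewrite gromov_prodC /gromov_prod /word_dist expgS mulKg; lra.
Qed.

(** Lengths of powers grow by at least [len g - 2 * a - 2 * delta] per step, and the distance from
    [g ^+ m] to [g ^+ n] is the length of [g ^+ (n - m)]. *)
Lemma reduced_gp m n : (m <= n)%N ->
  m%:R * (len g - 2 * a - 2 * delta) <= gp (g ^+ m)%g (g ^+ n)%g.
Proof.
set e := len g - 2 * a - 2 * delta => mn.
have lenD k i : len (g ^+ i)%g + k%:R * e <= len (g ^+ (k + i))%g.
  elim: k => [|k IH]; first by rewrite mul0r addr0.
  by have := reduced_len (k + i); rewrite -/e addSn -natr1; lra.
have h1 := lenD m 0%N; have h2 := lenD m (n - m)%N.
rewrite addn0 expg0 word_length1 in h1; rewrite subnKC // in h2.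
have -> : gp (g ^+ m)%g (g ^+ n)%g
    = (len (g ^+ m)%g + len (g ^+ n)%g - len (g ^+ (n - m))%g) / 2.
  by rewrite /gromov_prod /word_dist -{2}(subnKC mn) expgnDr mulKg.
by lra.
Qed.

End Reduced.

Lemma reducedV g a : gp g^-1%g g <= a -> gp g^-1^-1%g g^-1%g <= a.
Proof. by rewrite invgK gromov_prodC. Qed.

Lemma reduced_gpV g a m n : gp g^-1%g g <= a -> 2 * a + 3 * delta < len g ->
  gp (g ^- m)%g (g ^+ n)%g <= a + 2 * delta.
Proof.
move=> ga lg; have d0 := delta_ge0 hyp.
have a0 : 0 <= a := le_trans (gromov_prod_ge0 R S _ _) ga.
case: n => [|n]; first by rewrite expg0 gromov_prod1; lra.
have h1 := reduced_gp_self ga lg n.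
have h2 : gp (g ^- m)%g g <= a + delta.
  rewrite gromov_prodC -expVgn -{1}(invgK g).
  by apply: reduced_gp_inv; rewrite ?word_lengthV // reducedV.
by have [h|h] := gromov_hyp_or hyp (g ^+ n.+1)%g (g ^- m)%g g; lra.
Qed.

(** Quantitative form of loxodromic: both rays of powers escape at linear speed, and [K] keeps their
    ends apart. *)
Definition axial (eps K : R) p : Prop :=
  [/\ 0 < eps,
      forall m n, (m <= n)%N -> m%:R * eps <= gp (p ^+ m)%g (p ^+ n)%g,
      forall m n, (m <= n)%N -> m%:R * eps <= gp (p ^- m)%g (p ^- n)%g
    & forall m n, gp (p ^- m)%g (p ^+ n)%g <= K].

Lemma axialV eps K p : axial eps K p -> axial eps K p^-1%g.
Proof.
move=> [e0 pp mm mp]; split => //.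
- by move=> m n mn; rewrite !expVgn mm.
- by move=> m n mn; rewrite !expVgn !invgK pp.
- by move=> m n; rewrite !expVgn !invgK gromov_prodC.
Qed.

Lemma axial_reduced g a : gp g^-1%g g <= a -> 2 * a + 3 * delta < len g ->
  axial (len g - 2 * a - 2 * delta) (a + 2 * delta) g.
Proof.
move=> ga lg; split.
- by have := delta_ge0 hyp; lra.
- by move=> m n; exact: reduced_gp.
- move=> m n mn; rewrite -!expVgn -(word_lengthV S g).
  by apply: reduced_gp; rewrite ?word_lengthV ?reducedV.
- by move=> m n; exact: reduced_gpV.
Qed.

Lemma axial_len eps K p n : axial eps K p -> n%:R * eps <= len (p ^+ n)%g.
Proof. by move=> [_ pp _ _]; rewrite -gromov_prodxx pp. Qed.

Lemma axial_infinite_order eps K p : axial eps K p -> infinite_order p.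
Proof.
move=> ax n n0 pn; have [e0 _ _ _] := ax.
have := axial_len n ax; rewrite pn word_length1; apply/negP; rewrite -ltNge.
by rewrite mulr_gt0 // ltr0n.
Qed.

Lemma axial_prod_to_infty eps K p : axial eps K p ->
  prod_to_infty R S (fun n => p ^+ n)%g (fun n => p ^+ n)%g.
Proof.
move=> [e0 pp _ _]; apply/prod_to_inftyP => r.
have rN : r <= (Num.truncn (r / eps)).+1%:R * eps.
  by rewrite -ler_pdivrMr //; exact/ltW/truncnS_gt.
exists (Num.truncn (r / eps)).+1 => i j Ni Nj; apply: le_trans rN _.
have [ij|ji] := leqP i j.
  by apply: le_trans (pp _ _ ij); rewrite ler_pM2r // ler_nat.
rewrite gromov_prodC; apply: le_trans (pp _ _ (ltnW ji)).
by rewrite ler_pM2r // ler_nat.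
Qed.

Lemma axial_attracting_ex eps K p : axial eps K p ->
  exists xi : bd, attracting_point p xi.
Proof. by move=> /axial_prod_to_infty/boundary_of_seq. Qed.

(** Multiplication by a power of [p] only shifts the sequence [p ^+ i]. *)
Lemma attracting_point_fixed p n xi : attracting_point p xi ->
  boundary_act (p ^+ n)%g xi = xi.
Proof.
move=> pxi; have := cvg_boundary_act (p ^+ n)%g pxi.
set y := fun i => _ => yE; apply: cvg_boundary_unique yE _.
apply: cvg_boundary_trans (pxi) _; apply/prod_to_inftyP => r.
have /prod_to_inftyP/(_ r)[N h] := cvg_boundary_self pxi.
exists N => i j Ni Nj; rewrite /y -expgnDr h //.
exact: leq_trans Nj (leq_addl _ _).
Qed.

(** * Loxodromic elements in nonelementary groups *)

Hypothesis nonel : nonelementary Gam.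

Lemma word_length_unbounded n : exists v, (n < word_length S v)%N.
Proof.
apply: contrapT => bnd; apply: nonel; have [f fP] := finite_word_ball S n.
exists 1%g, f => g; exists g; last by exists 0%N; left; rewrite expg0 mulg1.
by apply: fP; rewrite leqNgt; apply/negP => gn; apply: bnd; exists g.
Qed.

(** Otherwise there are [v n] such that [f * v n] has product above [n] with [(v n)^-1] for all [f]
    of length at most [n]. Then [f * v n] and [v n] are close, and the whole group fixes the limit
    of [v n]. *)
Lemma connecting_elements : exists C : nat, forall v, exists f,
  (word_length S f <= C)%N /\ gp v^-1%g (f * v)%g <= C%:R.
Proof.
apply: contrapT => /forallNP nC; apply: nonel.
have /choice[v vP] : forall n, exists v, forall f, (word_length S f <= n)%N ->
    n%:R < gp v^-1%g (f * v)%g.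
  move=> n; have /existsNP[v /forallNP vn] := nC n; exists v => f fn.
  by rewrite ltNge; apply/negP => h; apply: (vn f).
apply: (elementary_of_quasi_fixed hyp (v := v)) => g A.
near=> n; have An : A + delta <= n%:R.
  near: n; exists (Num.truncn (A + delta)).+1 => // n /= h.
  by apply: le_trans (ltW (truncnS_gt _)) _; rewrite ler_nat.
rewrite -(addrK delta A); apply: (gromov_hyp hyp (b := (v n)^-1%g)).
  rewrite gromov_prodC (le_trans An)// ltW// vP//.
  by near: n; exists (word_length S g).
rewrite -{2}(mul1g (v n)) (le_trans An)// ltW// vP// word_length1 //.
Unshelve. all: by end_near. Qed.

(** Take [f * v] with [v] long and [f] connecting: [f * v] and [v^-1] have bounded product, and
    [(f * v)^-1] is close to [v^-1], so [f * v] hardly backtracks. *)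
Lemma axial_ex : exists eps K p, axial eps K p.
Proof.
have d0 := delta_ge0 hyp; have [C CP] := connecting_elements.
have [v vP] := word_length_unbounded (Num.truncn (3 * C%:R + 6 * delta)).
have lv : 3 * C%:R + 6 * delta < len v.
  by apply: lt_le_trans (truncnS_gt _) _; rewrite ler_nat.
have [f [fC vf]] := CP v.
have lf : len f <= C%:R by rewrite ler_nat.
have lp : len v - len f <= len (f * v)%g.
  rewrite lerBlDr -natrD ler_nat addnC -{1}(mulKg f v) -(word_lengthV S f).
  exact: word_lengthM.
have C0 : 0 <= C%:R :> R := ler0n _ _.
exists (len (f * v)%g - 2 * (C%:R + delta) - 2 * delta).
exists (C%:R + delta + 2 * delta), (f * v)%g.
apply: axial_reduced; last by lra.
have := gromov_hyp_or hyp (f * v)^-1%g v^-1%g (f * v)%g.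
have -> : gp v^-1%g (f * v)^-1%g = (len v + len (f * v)%g - len f) / 2.
  rewrite /gromov_prod /word_dist invgK !word_lengthV invgM mulgA mulgV mul1g.
  by rewrite word_lengthV.
by move=> [h|h]; lra.
Qed.

(** If no [g] moved the attracting point, the powers of [p] would converge to a point fixed by the
    whole group, which would then be virtually cyclic. *)
Lemma attracting_moved eps K p xi : axial eps K p -> attracting_point p xi ->
  exists g r, (bprod (boundary_act g xi) xi <= r%:E)%E.
Proof.
move=> ax pxi; apply: contrapT => nfix; apply: nonel.
apply: (elementary_of_quasi_fixed hyp (v := fun n => p ^+ n)%g) => g A.
have Ag : ((A + 2 * delta)%:E < bprod (boundary_act g xi) xi)%E.
  rewrite ltNge; apply/negP => h; apply: nfix.
  by exists g, (A + 2 * delta).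
have [N NP] := bprod_gt_eventually_ge (cvg_boundary_act g pxi) pxi Ag.
exists N => // n /= Nn; have := NP n n Nn Nn; rewrite addrK //.
Qed.

End HyperbolicBoundary.

(** * North-south dynamics *)

Section NorthSouth.
Variables (R : realType) (Gam : groupType) (S : symGenSet Gam).
Local Notation len g := ((word_length S g)%:R : R).
Local Notation gp := (gromov_prod R S).
Local Notation bd := (boundary R S).
Variable delta : R.
Hypothesis hyp : forall a b c : Gam,
  Num.min (gp a b) (gp b c) - delta <= gp a c.
Variables (p : Gam) (eps K : R) (pp pm : bd).
Hypotheses (ax : axial S eps K p) (ppP : attracting_point p pp)
  (pmP : repelling_point p pm).
Implicit Types (x y : nat -> Gam) (r : R) (xi eta zeta : bd) (g h : Gam).

Lemma word_lengthX g n : (word_length S (g ^+ n)%g <= n * word_length S g)%N.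
Proof.
elim: n => [|n IH]; first by rewrite expg0 word_length1.
by rewrite expgS mulSn (leq_trans (word_lengthM _ _ _))// leq_add2l.
Qed.

Lemma nat_large (B : R) n0 : exists n, (n0 <= n)%N /\ B <= n%:R * eps.
Proof.
have [e0 _ _ _] := ax; exists (maxn n0 (Num.truncn (B / eps)).+1).
split; first exact: leq_maxl.
rewrite -ler_pdivrMr //; apply: le_trans (ltW (truncnS_gt _)) _.
by rewrite ler_nat leq_maxr.
Qed.

(** For uniformity in [n], compare with a later [p ^- j], where the product is controlled: either
    the control passes to [p ^- n], or [n * eps] is bounded and so is the length of [p ^- n]. *)
Lemma gp_negpow_bounded r : exists M : R, forall xi x,
  (bprod xi pm <= r%:E)%E -> cvg_boundary x xi ->
  exists N, forall i, (N <= i)%N -> forall n, gp (x i) (p ^- n)%g <= M.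
Proof.
have [e0 _ mm _] := ax; have d0 := delta_ge0 hyp.
pose s := r + 1 + 2 * delta + delta.
exists (s + s / eps * len p) => xi x xir xxi.
have [N NP] := bprod_le_eventually_le hyp xxi pmP xir.
exists N => i Ni n; pose j := maxn n N.
have ij : gp (x i) (p ^- j)%g <= s - delta.
  by apply: le_trans (NP i j Ni (leq_maxr _ _)) _; rewrite /s; lra.
have nj : n%:R * eps <= gp (p ^- n)%g (p ^- j)%g by apply/mm/leq_maxl.
have [h|h] := gromov_hyp_or hyp (p ^- n)%g (x i) (p ^- j)%g.
  have hs : gp (x i) (p ^- n)%g <= s by lra.
  apply: le_trans hs _; rewrite lerDl mulr_ge0 // divr_ge0 ?(ltW e0) //.
  by have := gromov_prod_ge0 R S (x i) (p ^- j)%g; lra.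
have ns : n%:R <= s / eps by rewrite ler_pdivlMr //; lra.
have s0 : 0 <= s by have := gromov_prod_ge0 R S (x i) (p ^- j)%g; lra.
apply: le_trans (gromov_prod_ler _ _ _ _) _; rewrite word_lengthV.
have lX := word_lengthX p n; rewrite -(ler_nat R) natrM in lX.
by apply: le_trans lX _; rewrite ler_wpDl // ler_wpM2r.
Qed.

(** By change of base point the product grows by the length of [p ^+ n], at least [n * eps], minus
    the products with [p ^- n], which stay bounded for points away from [pm]. *)
Lemma north_south r : exists M : R, forall xi eta,
  (bprod xi pm <= r%:E)%E -> (bprod eta pm <= r%:E)%E ->
  forall n, (bprod xi eta + (n%:R * eps - M)%:E
    <= bprod (boundary_act (p ^+ n)%g xi) (boundary_act (p ^+ n)%g eta))%E.
Proof.
have [M MP] := gp_negpow_bounded r; exists (2 * M) => xi eta xir etar n.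
apply: bprod_shift => x y xxi yeta.
exists (fun i => p ^+ n * x i)%g, (fun i => p ^+ n * y i)%g.
split; [exact: cvg_boundary_act | exact: cvg_boundary_act | ].
have [[N1 NP1] [N2 NP2]] := (MP _ _ xir xxi, MP _ _ etar yeta).
move=> t [N3 NP3]; exists (maxn (maxn N1 N2) N3) => i j.
rewrite !geq_max -!andbA => /and3P[N1i _ N3i] /and3P[_ N2j N3j].
rewrite gromov_prodM; have := NP1 i N1i n; have := NP2 j N2j n.
by have := NP3 i j N3i N3j; have := axial_len n ax; lra.
Qed.

Lemma attracting_repelling_far : exists r, (bprod pp pm <= r%:E)%E.
Proof.
have [_ _ _ mp] := ax; exists (K + 2 * delta + 1).
rewrite leNgt; apply/negP => h.
have [N NP] := bprod_gt_eventually_ge hyp ppP pmP h.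
have := NP N N (leqnn _) (leqnn _); rewrite gromov_prodC.
by have := mp N N; lra.
Qed.

(** For large [n], [q^-1] is close to [p ^- n], which has bounded product with [q = g * p ^+ n]
    because [g pp] is apart from [pm]. So [q] is axial, and its attracting point is close to [q],
    hence to [g pp]. *)
Lemma translate_attracting g r (A : R) n0 :
  (bprod (boundary_act g pp) pm <= r%:E)%E ->
  exists n zeta, [/\ (n0 <= n)%N, infinite_order (g * p ^+ n)%g,
    attracting_point (g * p ^+ n)%g zeta &
    (A%:E <= bprod zeta (boundary_act g pp))%E].
Proof.
move=> gr; have [e0 ppe _ _] := ax; have d0 := delta_ge0 hyp.
have gpp := cvg_boundary_act g ppP.
have [N NP] := bprod_le_eventually_le hyp gpp pmP gr.
set s := r + 1 + 2 * delta in NP.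
have s0 : 0 <= s.
  exact: le_trans (gromov_prod_ge0 R S _ _) (NP N N (leqnn _) (leqnn _)).
have [n [n0n nB]] :=
  nat_large (len g + `|A| + 3 * s + 10 * delta + 1) (maxn n0 N).
move: n0n; rewrite geq_max => /andP[n0n Nn].
have A0 := normr_ge0 A; have AA := ler_norm A.
set q := (g * p ^+ n)%g.
have ln := axial_len n ax.
have lq : len (p ^+ n)%g - len g <= len q.
  rewrite lerBlDr -natrD ler_nat addnC -{1}(mulKg g (p ^+ n)%g).
  by rewrite -(word_lengthV S g) word_lengthM.
have qs : gp q^-1%g q <= s + delta.
  have qn : gp (p ^- n)%g q <= s by rewrite gromov_prodC NP.
  have [h|h] := gromov_hyp_or hyp q^-1%g (p ^- n)%g q; last by lra.
  have E : gp (p ^- n)%g q^-1%g = (len (p ^+ n)%g + len q - len g) / 2.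
    rewrite /gromov_prod /word_dist invgK !word_lengthV /q invgM mulgA mulgV.
    by rewrite mul1g word_lengthV.
  by have := ler0n R (word_length S g); lra.
have lq' : 2 * (s + delta) + 3 * delta < len q by lra.
have axq := axial_reduced hyp qs lq'.
have [zeta zetaP] := axial_attracting_ex axq.
exists n, zeta; split => //; first exact: axial_infinite_order axq.
apply: eventually_ge_bprod (zetaP) (gpp) _.
(* Starting at [n.+1] makes [i] positive, as [q ^+ 0] is not close to [q]. *)
exists n.+1 => i j ni nj; rewrite -(addrK delta A).
apply: (gromov_hyp hyp (b := q)).
  case: i ni => // i _; apply: le_trans (reduced_gp_self hyp qs lq' i); lra.
apply: le_trans (gromov_prodMl R S g (p ^+ n)%g (p ^+ j)%g).
by have := ppe n j (ltnW nj); rewrite word_lengthV; lra.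
Qed.

(** As [p ^+ m0] and [g0 * p ^+ m0] are apart, one of them has bounded product with [(x n)^-1].
    Translated by [x n], it is close to [x n], hence to [xi]. *)
Lemma orbit_dense g0 r0 xi (A : R) :
  (bprod (boundary_act g0 pp) pp <= r0%:E)%E ->
  exists g, (A%:E <= bprod (boundary_act g pp) xi)%E.
Proof.
move=> g0r; have [e0 ppe _ _] := ax; have d0 := delta_ge0 hyp.
have [N NP] := bprod_le_eventually_le hyp (cvg_boundary_act g0 ppP) ppP g0r.
set s := r0 + 1 + 2 * delta in NP.
have [m0 [Nm0 m0B]] := nat_large (s + 2 * delta + len g0 + 1) N.
have [x xxi] := cvg_boundary_ex xi.
have /prod_to_inftyP/(_ (A + s + 4 * delta))[n nP] := cvg_boundary_self xxi.
have s0 : 0 <= s.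
  exact: le_trans (gromov_prod_ge0 R S _ _) (NP N N (leqnn _) (leqnn _)).
have key g : (forall m, (m0 <= m)%N ->
      gp (g * p ^+ m)%g (x n)^-1%g <= s + 2 * delta) ->
    (A%:E <= bprod (boundary_act (x n * g)%g pp) xi)%E.
  move=> gP; apply: eventually_ge_bprod (cvg_boundary_act _ ppP) (xxi) _.
  exists (maxn m0 n) => m j; rewrite !geq_max => /andP[m0m _] /andP[_ nj].
  rewrite -(addrK delta A); apply: (gromov_hyp hyp (b := x n)); last first.
    by have := nP n j (leqnn _) nj; lra.
  have := gromov_prodM R S (x n) (g * p ^+ m)%g 1%g.
  rewrite mulg1 mulgA gromov_prod1 (gromov_prodC _ _ 1%g) gromov_prod1 => ->.
  have := nP n n (leqnn _) (leqnn _); rewrite gromov_prodxx.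
  by have := gP m m0m; lra.
have e1 : len g0 >= 0 := ler0n _ _.
have far g : len g <= len g0 -> gp (g * p ^+ m0)%g (x n)^-1%g <= s + delta ->
    forall m, (m0 <= m)%N -> gp (g * p ^+ m)%g (x n)^-1%g <= s + 2 * delta.
  move=> gl h m m0m.
  have h2 := gromov_prodMl R S g (p ^+ m0)%g (p ^+ m)%g.
  have := ppe m0 m m0m; rewrite word_lengthV in h2.
  by have [h1|h1] := gromov_hyp_or hyp (g * p ^+ m)%g (g * p ^+ m0)%g (x n)^-1%g;
    lra.
have h := NP m0 m0 Nm0 Nm0.
have [h1|h1] := gromov_hyp_or hyp (x n)^-1%g (g0 * p ^+ m0)%g (p ^+ m0)%g.
  by exists (x n * g0)%g; apply/key/far => //; lra.
exists (x n * 1)%g; apply/key/far; first by rewrite word_length1.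
by rewrite mul1g gromov_prodC; lra.
Qed.

End NorthSouth.

(** * Geometric convergence in bi-invariant metrics *)

Section Geometric.
Variables (R : realType) (q : R).
Hypotheses (q0 : 0 < q) (q1 : q < 1).

Lemma geometric_small (C e : R) : 0 < e -> exists n, C * q ^+ n <= e.
Proof.
move=> e0; have : `|q| < 1 by rewrite gtr0_norm.
move=> /(cvg_geometric C)/cvgrPdist_le/(_ e e0)[N _ /(_ N (leqnn _))].
rewrite /= sub0r normrN /geometric /= => h.
by exists N; exact: le_trans (ler_norm _) h.
Qed.

Lemma le_of_geometric (x y C : R) :
  (forall n, x <= y + C * q ^+ n) -> x <= y.
Proof.
move=> h; apply/ler_addgt0Pr => e e0; have [n ne] := geometric_small C e0.
by apply: le_trans (h n) _; rewrite lerD2l.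
Qed.

Lemma le_sum_geometric (u : nat -> R) (D : R) : 0 <= D -> u 0%N <= 0 ->
  (forall n, u n.+1 <= u n + D * q ^+ n) -> forall n, u n <= D / (1 - q).
Proof.
move=> D0 u0 uS n; have q1' : 0 < 1 - q by rewrite subr_gt0.
(* The induction goes through for the exact partial sum of the geometric series. *)
suff : u n <= D / (1 - q) * (1 - q ^+ n).
  move/le_trans; apply; rewrite ler_piMr ?divr_ge0 ?(ltW q1') //.
  by rewrite lerBlDr lerDl exprn_ge0 // ltW.
elim: n => [|n IH]; first by rewrite expr0 subrr mulr0.
apply: le_trans (uS n) _; apply: le_trans (lerD IH (lexx _)) _.
rewrite le_eqVlt; apply/orP; left; apply/eqP; rewrite exprS.
have /mulVf h : 1 - q != 0 by rewrite gt_eqF.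
set a := q ^+ n; have -> : D * a = D * ((1 - q)^-1 * (1 - q)) * a by rewrite h mulr1.
by ring.
Qed.

End Geometric.

Section BiInvariantMetric.
Variables (R : realType) (G : biInvCompleteGroupType R).
Implicit Types x y z : G.
Local Notation rho := (@mdist R G).

Lemma mdist_eq0 x y : (forall e, 0 < e -> rho x y <= e) -> x = y.
Proof.
move=> h; apply: mdist_positivity; apply/le_anti; rewrite mdist_ge0 andbT.
by apply/ler_addgt0Pr => e e0; rewrite add0r h.
Qed.

Lemma mdistM x y z t : rho (x * y)%g (z * t)%g <= rho x z + rho y t.
Proof.
apply: le_trans (metric_triangle _ (z * y)%g _) _.
by rewrite mdist_mulgr mdist_mulg.
Qed.

Lemma mdist_quad x y z t : rho x t <= rho x y + rho y z + rho z t.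
Proof.
apply: le_trans (metric_triangle _ z _) _.
by rewrite lerD2r metric_triangle.
Qed.

(** The limit is chosen before the constant [C], so that one function [b0] later serves every bound
    [r]. When no [C] works the claim is vacuous and [1] is taken. *)
Lemma metric_geometric_cvg (q : R) (u : nat -> G) : 0 < q -> q < 1 ->
  exists l, forall C, (forall n, rho (u n) (u n.+1) <= C * q ^+ n) ->
    forall n, rho (u n) l <= C / (1 - q) * q ^+ n.
Proof.
move=> q0 q1.
have tele C : (forall n, rho (u n) (u n.+1) <= C * q ^+ n) ->
    forall n k, rho (u n) (u (n + k)%N) <= C / (1 - q) * q ^+ n.
  move=> uC n k; have C0 : 0 <= C.
    by have := le_trans (mdist_ge0 _ _) (uC 0%N); rewrite expr0 mulr1.
  rewrite mulrAC; apply: (le_sum_geometric q0 q1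
    (u := fun k => rho (u n) (u (n + k)%N))).
  - by rewrite mulr_ge0 // exprn_ge0 // ltW.
  - by rewrite addn0 mdistxx.
  - move=> m; apply: le_trans (metric_triangle _ (u (n + m)%N) _) _.
    by rewrite lerD2l addnS -mulrA -exprD.
have [[C uC]|nC] := pselect (exists C, forall n, rho (u n) (u n.+1) <= C * q ^+ n);
  last by exists 1%g => C uC; case: nC; exists C.
have uc : cvg (u @ \oo).
  apply: cauchy_cvg; apply: cauchy_exP => e e0.
  have [n ne] := geometric_small q0 q1 (C / (1 - q)) (e := e / 2) ltac:(lra).
  exists (u n); exists n => // m /= nm.
  rewrite ballEmdist /= -(subnKC nm).
  by have := tele C uC n (m - n)%N; lra.
exists (lim (u @ \oo)) => D uD n; apply/ler_addgt0Pr => e e0.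
have /cvg_ballP/(_ e e0)[N _ NP] : u @ \oo --> lim (u @ \oo) by exact: uc.
apply: le_trans (metric_triangle _ (u (n + N)%N) _) _.
apply: lerD; first exact: tele.
have /= := NP (n + N)%N (leq_addl _ _).
by rewrite ballEmdist /= metric_sym => /ltW.
Qed.

End BiInvariantMetric.

(** * Exponential weights of extended Gromov products *)

Section PowREreal.
Variables (R : realType) (tau : R).
Hypotheses (tau_gt0 : 0 < tau) (tau_lt1 : tau < 1).
Local Notation pw := (powR_ereal tau).

Lemma powR_ereal_ge0 u : 0 <= pw u.
Proof. by case: u => //= r; exact: powR_ge0. Qed.

Lemma powR_le (r s : R) : r <= s -> tau `^ s <= tau `^ r.
Proof. by move=> rs; apply: ger_powR => //; rewrite tau_gt0 ltW. Qed.

(** [0 <= u] excludes [-oo], where [powR_ereal] has an arbitrary value; [u = +oo] forces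
    [v = +oo]. *)
Lemma powR_ereal_shift u v (s : R) : (0 <= u)%E -> (u + s%:E <= v)%E ->
  pw v <= tau `^ s * pw u.
Proof.
case: u => [r| |] // _; case: v => [t| |] //=; rewrite ?mulr_ge0 ?powR_ge0 //.
rewrite -EFinD lee_fin -powRD; last by rewrite (gt_eqF tau_gt0) implybT.
by rewrite addrC; exact: powR_le.
Qed.

Lemma powR_ereal_le (A : R) v : (A%:E <= v)%E -> pw v <= tau `^ A.
Proof.
case: v => [t| |] //=; rewrite ?powR_ge0 //.
by rewrite lee_fin; exact: powR_le.
Qed.

Lemma powR_ereal_le1 v : (0 <= v)%E -> pw v <= 1.
Proof. by move=> /powR_ereal_le; rewrite powRr0. Qed.

Lemma powR_ereal_ge (A : R) v : (0 <= v)%E -> (v <= A%:E)%E -> tau `^ A <= pw v.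
Proof. by case: v => [t| |] //= _; rewrite lee_fin; exact: powR_le. Qed.

End PowREreal.

(** * The transfer function *)

Section Coboundary.
Variables (R : realType) (Gam : groupType) (S : symGenSet Gam).
Local Notation len g := ((word_length S g)%:R : R).
Local Notation gp := (gromov_prod R S).
Local Notation bd := (boundary R S).
Variable delta : R.
Hypothesis hyp : forall a b c : Gam,
  Num.min (gp a b) (gp b c) - delta <= gp a c.
Variables (p : Gam) (eps K : R) (pp pm : bd).
Hypotheses (ax : axial S eps K p) (ppP : attracting_point p pp)
  (pmP : repelling_point p pm).
Variables (G : biInvCompleteGroupType R) (c : Gam -> bd -> G).
Variable (tau : R).
Hypotheses (tau_gt0 : 0 < tau) (tau_lt1 : tau < 1).
Local Notation pw := (powR_ereal tau).
Local Notation rho := (@mdist R G).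
Local Notation act := (@boundary_act R Gam S).
Hypothesis c_holder : forall g : Gam, exists A : R, 0 < A /\
  forall xi eta : bd, rho (c g xi) (c g eta) <= A * pw (bprod xi eta).
Hypothesis c_cocycle : forall (g h : Gam) (omega : bd),
  c (g * h)%g omega = (c g omega * c h (act g^-1%g omega))%g.
Hypothesis c_attracting : forall (g : Gam) (xi : bd),
  infinite_order g -> attracting_point g xi -> c g xi = 1%g.
Implicit Types (xi eta zeta omega : bd) (g h k : Gam) (r : R).

(** Rate at which iterating [p] contracts [tau ^ (xi | eta)] away from [pm]. *)
Let q : R := tau `^ eps.

Let q_gt0 : 0 < q. Proof. exact: powR_gt0. Qed.

Let q_lt1 : q < 1.
Proof.
have [e0 _ _ _] := ax; rewrite /q -(powRr0 tau) /powR gt_eqF //.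
by rewrite mul0r ltr_expR mulrC nmulr_rlt0 // ln_lt0 // tau_gt0.
Qed.

Lemma powR_nat_eps n : tau `^ (n%:R * eps) = q ^+ n.
Proof. by rewrite mulrC powRrM powR_mulrn // powR_ge0. Qed.

Lemma cocycle1 xi : c 1%g xi = 1%g.
Proof.
have := c_cocycle 1%g 1%g xi; rewrite mulg1 invg1 boundary_act1.
by rewrite -{1}(mulg1 (c 1%g xi)) => /mulgI.
Qed.

Lemma cocycleV g xi : c g^-1%g (act g^-1%g xi) = (c g xi)^-1%g.
Proof.
have := c_cocycle g g^-1%g xi; rewrite mulgV cocycle1 => /esym/mulg1_eq <-.
by [].
Qed.

Let bN n xi : G := c (p ^- n)%g xi.

Lemma backward_cocycleS n xi : bN n.+1 xi = (bN n xi * c p^-1%g (act (p ^+ n)%g xi))%g.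
Proof. by rewrite /bN expgS invgM c_cocycle invgK. Qed.

(** By north-south dynamics the increments [c p^-1] at [p ^+ n xi] and [p ^+ n eta] differ by at
    most a constant times [q ^+ n * tau ^ (xi | eta)]; the sum over [n] converges. *)
Lemma backward_cocycle_holder r : exists C, 0 <= C /\ forall n xi eta,
  (bprod xi pm <= r%:E)%E -> (bprod eta pm <= r%:E)%E ->
  rho (bN n xi) (bN n eta) <= C * pw (bprod xi eta).
Proof.
have [M MP] := north_south hyp ax pmP r; have [A [A0 AP]] := c_holder p^-1%g.
have q1 : 0 < 1 - q by rewrite subr_gt0 q_lt1.
exists (A * tau `^ (- M) / (1 - q)); split.
  by rewrite divr_ge0 ?mulr_ge0 ?powR_ge0 // ltW.
move=> n xi eta xir etar; rewrite mulrAC.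
apply: (le_sum_geometric q_gt0 q_lt1 (u := fun n => rho (bN n xi) (bN n eta))).
- by rewrite !mulr_ge0 ?powR_ge0 ?powR_ereal_ge0 // ltW.
- by rewrite /bN expg0 invg1 !cocycle1 mdistxx.
- move=> m; rewrite !backward_cocycleS; apply: le_trans (mdistM _ _ _ _) _.
  rewrite lerD2l; apply: le_trans (AP _ _) _; rewrite -!mulrA ler_pM2l //.
  have := powR_ereal_shift tau_gt0 tau_lt1 (bprod_ge0 xi eta) (MP _ _ xir etar m).
  rewrite powRD ?(gt_eqF tau_gt0) ?implybT // powR_nat_eps.
  by rewrite -mulrA (mulrC (q ^+ m)) mulrA mulrAC.
Qed.

(** As [c p^-1] is trivial at [pp] and [p ^+ n xi] tends to the fixed point [pp] at rate [q], the
    successive factors tend to 1 geometrically. *)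
Lemma backward_cocycle_cauchy r : exists C, 0 <= C /\ forall xi,
  (bprod xi pm <= r%:E)%E -> forall n, rho (bN n xi) (bN n.+1 xi) <= C * q ^+ n.
Proof.
have [r0 ppr0] := attracting_repelling_far hyp ax ppP pmP.
(* Including [r0] makes the estimate apply to the pair of [xi] and [pp]. *)
have [M MP] := north_south hyp ax pmP (Num.max r r0).
have [A [A0 AP]] := c_holder p^-1%g.
exists (A * tau `^ (- M)); split; first by rewrite mulr_ge0 ?powR_ge0 // ltW.
move=> xi xir n.
have xir' : (bprod xi pm <= (Num.max r r0)%:E)%E.
  by apply: le_trans xir _; rewrite lee_fin le_max lexx.
have ppr' : (bprod pp pm <= (Num.max r r0)%:E)%E.
  by apply: le_trans ppr0 _; rewrite lee_fin le_max lexx orbT.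
have cp : c p^-1%g pp = 1%g.
  have := cocycleV p pp; rewrite (c_attracting (axial_infinite_order ax) ppP).
  by rewrite invg1 -{1}(attracting_point_fixed hyp 1 ppP) expg1 boundary_actK.
rewrite backward_cocycleS -{1}(mulg1 (bN n xi)) mdist_mulg -cp metric_sym.
apply: le_trans (AP _ _) _; rewrite -mulrA ler_pM2l //.
have := powR_ereal_shift tau_gt0 tau_lt1 (bprod_ge0 xi pp) (MP _ _ xir' ppr' n).
rewrite (attracting_point_fixed hyp n ppP) => /le_trans; apply.
rewrite powRD ?(gt_eqF tau_gt0) ?implybT // powR_nat_eps.
rewrite -[X in _ <= X]mulr1 (mulrC (q ^+ n)) ler_wpM2l //.
  by rewrite mulr_ge0 ?powR_ge0 // exprn_ge0 // ltW // q_gt0.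
by apply: powR_ereal_le1 => //; exact: bprod_ge0.
Qed.

Lemma backward_cocycle_cvg : exists b0 : bd -> G, forall r, exists C, 0 <= C /\ forall xi,
  (bprod xi pm <= r%:E)%E -> forall n, rho (bN n xi) (b0 xi) <= C * q ^+ n.
Proof.
have /choice[b0 b0P] := fun xi =>
  metric_geometric_cvg (fun n => bN n xi) q_gt0 q_lt1.
exists b0 => r; have [C [C0 CP]] := backward_cocycle_cauchy r.
exists (C / (1 - q)); split.
  by rewrite divr_ge0 // subr_ge0 ltW // q_lt1.
by move=> xi xir; apply: b0P; exact: CP.
Qed.

Variable b0 : bd -> G.
Hypothesis b0_lim : forall r, exists C, 0 <= C /\ forall xi,
  (bprod xi pm <= r%:E)%E -> forall n, rho (bN n xi) (b0 xi) <= C * q ^+ n.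

Lemma b0_holder r : exists C, 0 <= C /\ forall xi eta,
  (bprod xi pm <= r%:E)%E -> (bprod eta pm <= r%:E)%E ->
  rho (b0 xi) (b0 eta) <= C * pw (bprod xi eta).
Proof.
have [[C [C0 CP]] [D [D0 DP]]] := (backward_cocycle_holder r, b0_lim r).
exists C; split=> // xi eta xir etar.
apply: (le_of_geometric q_gt0 q_lt1 (C := 2 * D)) => n.
apply: le_trans (mdist_quad _ (bN n xi) (bN n eta) _) _.
have := CP n xi eta xir etar; have := DP xi xir n; have := DP eta etar n.
by rewrite (metric_sym (b0 xi)); lra.
Qed.

Lemma b0_bounded r : exists D, 0 <= D /\ forall xi,
  (bprod xi pm <= r%:E)%E -> rho (b0 xi) 1%g <= D.
Proof.
have [D [D0 DP]] := b0_lim r; exists D; split=> // xi /DP/(_ 0%N).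
by rewrite /bN expg0 invg1 cocycle1 expr0 mulr1 metric_sym.
Qed.

(** Were [eta] close to [pm], then [xi], being close to [eta], would be too. *)
Lemma far_perturb r (A : R) xi eta : (bprod xi pm <= r%:E)%E ->
  (A%:E <= bprod xi eta)%E -> r + 3 * delta + 1 < A ->
  (bprod eta pm <= (r + 3 * delta + 1)%:E)%E.
Proof.
move=> xir Axi rA; rewrite leNgt; apply/negP => h.
have h' : ((r + 3 * delta + 1)%:E < bprod xi eta)%E.
  by apply: lt_le_trans Axi; rewrite lte_fin.
have := le_trans (bprod_hyp hyp h' h) xir; rewrite lee_fin; lra.
Qed.

(* The attracting points [zeta] of [g p^n] satisfy [c (p^-n) zeta = c g zeta],
   by the hypothesis on [c] and the cocycle identity. *)
Lemma b0_orbit r g : (bprod (act g pp) pm <= r%:E)%E ->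
  b0 (act g pp) = c g (act g pp).
Proof.
move=> gr; apply: mdist_eq0 => e e0.
set r' := r + 3 * delta + 1; set xi := act g pp.
have d0 := delta_ge0 hyp.
have rr' : (r%:E <= r'%:E)%E by rewrite lee_fin /r'; lra.
have [[C [C0 CP]] [D [D0 DP]]] := (backward_cocycle_holder r', b0_lim r').
have [A [A0 AP]] := c_holder g.
have [n0 n0e] := geometric_small q_gt0 q_lt1 (D + C + A) e0.
have [n [zeta [n0n io zetaP Azeta]]] := translate_attracting hyp ax ppP pmP
  (Num.max (n0%:R * eps) (r' + 1)) n0 gr.
have zr : (bprod zeta pm <= r'%:E)%E.
  apply: (far_perturb (A := r' + 1) gr); last by rewrite -/r'; lra.
  rewrite bprodC; apply: le_trans Azeta.
  by rewrite lee_fin le_max lexx orbT.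
(* Since [g * p ^+ n] fixes [zeta], [p ^- n] carries [g^-1 zeta] to [zeta], so [c (p ^- n) zeta] is
   inverse to [c (p ^+ n) (g^-1 zeta)]. *)
have cz : bN n zeta = c g zeta.
  have := c_attracting io zetaP; rewrite c_cocycle => h.
  rewrite /bN -[LHS]mul1g -h -mulgA -[RHS]mulg1; congr (_ * _)%g.
  have := cocycleV (p ^+ n)%g (act g^-1%g zeta).
  rewrite -boundary_actM -invgM.
  rewrite -{1}(attracting_point_fixed hyp 1 zetaP) expg1 boundary_actK => ->.
  by rewrite mulgV.
have zA : pw (bprod zeta xi) <= q ^+ n0.
  rewrite -powR_nat_eps; apply: powR_ereal_le => //.
  by apply: le_trans Azeta; rewrite lee_fin le_max lexx.
have qn : q ^+ n <= q ^+ n0.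
  by rewrite ler_wiXn2l ?(ltW q_gt0) ?(ltW q_lt1).
apply: le_trans n0e.
(* The path from [b0 xi] through [bN n xi] and [bN n zeta] to [c g xi] costs [D], [C] and [A] times
   [q ^+ n0]. *)
apply: le_trans (mdist_quad _ (bN n xi) (bN n zeta) _) _.
rewrite !mulrDl; apply: lerD; first apply: lerD.
- rewrite metric_sym; apply: le_trans (DP _ (le_trans gr rr') n) _.
  exact: ler_wpM2l.
- apply: le_trans (CP n _ _ (le_trans gr rr') zr) _.
  by rewrite bprodC ler_wpM2l.
- by rewrite cz; apply: le_trans (AP _ _) _; rewrite ler_pM2l.
Qed.

Hypothesis pp_moved : exists g r, (bprod (act g pp) pp <= r%:E)%E.

(* Both sides are continuous and agree on the orbit of [pp], which is dense. *)
Lemma b0_cocycle r g xi :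
  (bprod xi pm <= r%:E)%E -> (bprod (act g^-1%g xi) pm <= r%:E)%E ->
  b0 xi = (c g xi * b0 (act g^-1%g xi))%g.
Proof.
move=> xir gxir; apply: mdist_eq0 => e e0.
set r' := r + 3 * delta + 1; have d0 := delta_ge0 hyp.
have rr' : (r%:E <= r'%:E)%E by rewrite lee_fin /r'; lra.
have [C [C0 CP]] := b0_holder r'; have [A [A0 AP]] := c_holder g.
have [n0 n0e] := geometric_small q_gt0 q_lt1 (C + A + C * tau `^ (- len g)) e0.
have [g0 [r0 g0r]] := pp_moved.
(* The first entry makes [omega] close to [xi]; the second absorbs the loss [len g] under [g^-1], so
   that [omega] and [g^-1 omega] both stay away from [pm]. *)
pose B := Num.max (n0%:R * eps) (r' + 1 + len g).
have [y yB] := orbit_dense hyp ax ppP xi B g0r.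
set omega := act y pp in yB.
have wA : pw (bprod xi omega) <= q ^+ n0.
  rewrite -powR_nat_eps bprodC; apply: powR_ereal_le => //.
  by apply: le_trans yB; rewrite lee_fin le_max lexx.
have Bx : ((r' + 1 + len g)%:E <= bprod xi omega)%E.
  by rewrite bprodC; apply: le_trans yB; rewrite lee_fin le_max lexx orbT.
have actg := bprod_act g^-1%g xi omega; rewrite word_lengthV in actg.
have Bgx : ((r' + 1)%:E <= bprod (act g^-1%g xi) (act g^-1%g omega))%E.
  apply: le_trans actg; apply: le_trans (leeD2r _ Bx).
  by rewrite -EFinD lee_fin; lra.
have wr : (bprod omega pm <= r'%:E)%E.
  by apply: far_perturb xir Bx _; rewrite -/r'; have := ler0n R (word_length S g); lra.
have gwr : (bprod (act g^-1%g omega) pm <= r'%:E)%E.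
  by apply: far_perturb gxir Bgx _; rewrite -/r'; lra.
have E : b0 omega = (c g omega * b0 (act g^-1%g omega))%g.
  have gw : act g^-1%g omega = act (g^-1 * y)%g pp by rewrite boundary_actM.
  rewrite (b0_orbit wr) -/omega gw; rewrite gw in gwr.
  by rewrite (b0_orbit gwr) -gw -c_cocycle mulVKg.
apply: le_trans n0e; apply: le_trans (metric_triangle _ (b0 omega) _) _.
rewrite !mulrDl -addrA; apply: lerD.
  apply: le_trans (CP _ _ (le_trans xir rr') wr) _; exact: ler_wpM2l.
rewrite E; apply: le_trans (mdistM _ _ _ _) _; apply: lerD.
  by apply: le_trans (AP _ _) _; rewrite bprodC ler_pM2l.
apply: le_trans (CP _ _ gwr (le_trans gxir rr')) _.
rewrite bprodC -mulrA ler_wpM2l //.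
apply: le_trans (powR_ereal_shift tau_gt0 tau_lt1 (bprod_ge0 _ _) actg) _.
by rewrite ler_wpM2l ?powR_ge0.
Qed.

(** * Extension across the repelling point *)

Variables (g1 : Gam) (r1 : R).
Hypothesis pm_moved : (bprod (act g1 pm) pm <= r1%:E)%E.

(** If [xi] and [g1^-1 xi] were both close to [pm], then [xi] would be close to [pm] and to [g1 pm],
    which are apart. So [1] and [g1] give two charts covering the boundary. *)
Lemma far_cover : exists r, forall xi, exists2 k, k \in [:: 1%g; g1] &
  (bprod (act k^-1%g xi) pm <= r%:E)%E.
Proof.
have d0 := delta_ge0 hyp; have l0 := ler0n R (word_length S g1).
exists (r1 + 3 * delta + 1 + len g1) => xi.
set r := _ + len g1.
have [h|h] := leP (bprod xi pm) r%:E.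
  by exists 1%g; rewrite ?mem_head // invg1 boundary_act1.
exists g1; first by rewrite !inE eqxx orbT.
rewrite leNgt; apply/negP => h'.
have h1 : ((r1 + 3 * delta + 1)%:E < bprod xi pm)%E.
  by apply: le_lt_trans h; rewrite lee_fin /r; lra.
have h2 : ((r1 + 3 * delta + 1)%:E < bprod (act g1 pm) xi)%E.
  have := bprod_act g1 (act g1^-1%g xi) pm; rewrite boundary_actVK bprodC.
  rewrite (bprodC xi); apply: lt_le_trans.
  by rewrite EFinN lteBrDr // -EFinD bprodC.
have := le_trans (bprod_hyp hyp h2 h1) pm_moved; rewrite lee_fin; lra.
Qed.

(** Two choices [k0] and [k] give the same value by the relation for [b0], applied to [k0^-1 * k] at
    the point [k0^-1 xi]. *)
Lemma b_exists : exists b : bd -> G, forall xi k r,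
  (bprod (act k^-1%g xi) pm <= r%:E)%E ->
  b xi = (c k xi * b0 (act k^-1%g xi))%g.
Proof.
have [r rP] := far_cover.
suff /choice : forall xi, exists x, forall k r,
  (bprod (act k^-1%g xi) pm <= r%:E)%E -> x = (c k xi * b0 (act k^-1%g xi))%g.
  by move=> [b bP]; exists b.
move=> xi; have [k0 _ k0r] := rP xi.
exists (c k0 xi * b0 (act k0^-1%g xi))%g => k s ks.
have E : act (k0^-1 * k)^-1%g (act k0^-1%g xi) = act k^-1%g xi.
  by rewrite -boundary_actM invgM invgK mulgK.
rewrite (@b0_cocycle (Num.max r s) (k0^-1 * k)%g).
- by rewrite E mulgA -c_cocycle mulVKg.
- by apply: le_trans k0r _; rewrite lee_fin le_max lexx.
- by rewrite E; apply: le_trans ks _; rewrite lee_fin le_max lexx orbT.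
Qed.

Variable b : bd -> G.
Hypothesis bE : forall xi k r, (bprod (act k^-1%g xi) pm <= r%:E)%E ->
  b xi = (c k xi * b0 (act k^-1%g xi))%g.

(** If [k] is a chart at [xi], then [g^-1 * k] is one at [g^-1 xi] with the same image [k^-1 xi], so
    the factors [b0] cancel. *)
Lemma b_cocycle g xi : c g xi = (b xi * (b (act g^-1%g xi))^-1)%g.
Proof.
have [r rP] := far_cover; have [k _ kr] := rP xi.
have E : act (g^-1 * k)^-1%g (act g^-1%g xi) = act k^-1%g xi.
  by rewrite -boundary_actM invgM invgK mulgK.
rewrite (bE kr) (@bE (act g^-1%g xi) (g^-1 * k)%g r) E //.
by rewrite -{1}(mulVKg g k) c_cocycle invgM !mulgA mulgK mulgK.
Qed.

Lemma b_local k r : exists C D, [/\ 0 <= C, 0 <= D,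
  forall xi, (bprod (act k^-1%g xi) pm <= r%:E)%E -> rho (b xi) 1%g <= D &
  forall xi eta, (bprod (act k^-1%g xi) pm <= r%:E)%E ->
    (bprod (act k^-1%g eta) pm <= r%:E)%E ->
    rho (b xi) (b eta) <= C * pw (bprod xi eta)].
Proof.
have [C [C0 CP]] := b0_holder r; have [D [D0 DP]] := b0_bounded r.
have [A [A0 AP]] := c_holder k.
exists (A + C * tau `^ (- len k)), (A + rho (c k pm) 1%g + D); split.
- by rewrite addr_ge0 ?mulr_ge0 ?powR_ge0 // ltW.
- by rewrite !addr_ge0 ?mdist_ge0 // ltW.
- move=> xi xir; rewrite (bE xir) -[X in rho _ X](mulg1 1%g).
  apply: le_trans (mdistM _ _ _ _) _; apply: lerD (DP _ xir).
  apply: le_trans (metric_triangle _ (c k pm) _) _; rewrite lerD2r.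
  apply: le_trans (AP _ _) _; rewrite ger_pMr //.
  by apply: powR_ereal_le1 => //; exact: bprod_ge0.
- move=> xi eta xir etar; rewrite (bE xir) (bE etar) mulrDl.
  apply: le_trans (mdistM _ _ _ _) _; apply: lerD (AP _ _) _.
  apply: le_trans (CP _ _ xir etar) _; rewrite -mulrA ler_wpM2l //.
  have := bprod_act k^-1%g xi eta; rewrite word_lengthV.
  exact: (powR_ereal_shift tau_gt0 tau_lt1 (bprod_ge0 _ _)).
Qed.

(** Pairs with large product share a chart, where [b] is Hoelder; for the others [tau ^ (xi | eta)]
    is bounded below and boundedness of [b] suffices. *)
Lemma b_holder : exists A, 0 < A /\
  forall xi eta, rho (b xi) (b eta) <= A * pw (bprod xi eta).
Proof.
have d0 := delta_ge0 hyp; have [r rP] := far_cover.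
pose r' := r + 3 * delta + 1.
have rr' : (r%:E <= r'%:E)%E by rewrite lee_fin /r'; lra.
have [C1 [D1 [C10 D10 b1 h1]]] := b_local 1%g r'.
have [C2 [D2 [C20 D20 b2 h2]]] := b_local g1 r'.
(* The margin [len g1] pays for applying [g1^-1]. *)
pose T := r' + 1 + len g1.
have bD xi : rho (b xi) 1%g <= D1 + D2.
  have [k] := rP xi; rewrite !inE => /orP[|] /eqP -> /le_trans/(_ rr') kr.
    by apply: le_trans (b1 _ kr) _; rewrite lerDl.
  by apply: le_trans (b2 _ kr) _; rewrite lerDr.
(* The summands serve the two charts and the pairs with small product; the final 1 ensures
   positivity. *)
exists (C1 + C2 + 2 * (D1 + D2) * tau `^ (- T) + 1); split.
  by rewrite ltr_wpDl // !addr_ge0 // !mulr_ge0 ?powR_ge0 // addr_ge0.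
move=> xi eta; have pw0 := powR_ereal_ge0 tau (bprod xi eta).
have P0 : 0 <= 2 * (D1 + D2) * tau `^ (- T).
  by rewrite !mulr_ge0 ?powR_ge0 // addr_ge0.
have [xT|Tx] := leP (bprod xi eta) T%:E.
  apply: le_trans (metric_triangle _ 1%g _) _.
  rewrite (metric_sym 1%g).
  apply: (@le_trans _ _ (2 * (D1 + D2))).
    by have := bD xi; have := bD eta; lra.
  apply: (@le_trans _ _ (2 * (D1 + D2) * tau `^ (- T) * pw (bprod xi eta))).
    rewrite -mulrA ler_peMr // ?mulr_ge0 ?addr_ge0 //.
    rewrite powRN mulrC ler_pdivlMr ?powR_gt0 // mul1r.
    by apply: powR_ereal_ge => //; exact: bprod_ge0.
  by rewrite ler_wpM2r //; lra.
have [k] := rP xi; rewrite !inE => /orP[|] /eqP -> kr.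
  apply: le_trans (h1 _ _ (le_trans kr rr') _) _.
    rewrite invg1 boundary_act1 in kr; rewrite invg1 boundary_act1.
    apply: far_perturb kr (ltW Tx) _; rewrite -/r' /T.
    by have := ler0n R (word_length S g1); lra.
  by rewrite ler_wpM2r //; lra.
apply: le_trans (h2 _ _ (le_trans kr rr') _) _.
  have := bprod_act g1^-1%g xi eta; rewrite word_lengthV => actg.
  apply: (far_perturb (A := r' + 1) kr); last by rewrite -/r'; lra.
  apply: le_trans actg; apply: le_trans (leeD2r _ (ltW Tx)).
  by rewrite -EFinD lee_fin /T; lra.
by rewrite ler_wpM2r //; lra.
Qed.

Lemma b_continuous : continuous b.
Proof.
have [A [A0 AP]] := b_holder.
apply/continuousP => U Uo; rewrite -[open _]/(boundary_open _) => xi Uxi.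
have /nbhs_ballP[e /= e0 eU] : nbhs (b xi) U by exact: open_nbhs_nbhs.
have [n ne] := geometric_small q_gt0 q_lt1 A (e := e / 2) ltac:(lra).
exists (n%:R * eps) => eta /= h; apply: eU; rewrite ballEmdist /=.
apply: le_lt_trans (AP _ _) _.
apply: (@le_lt_trans _ _ (A * q ^+ n)); last by lra.
rewrite ler_pM2l // -powR_nat_eps.
by apply: powR_ereal_le => //; exact: ltW.
Qed.

End Coboundary.

Unset Implicit Arguments.
Set Strict Implicit.

Theorem theorem5p1 (R : realType) (Gam : groupType) (S : symGenSet Gam)
    (hyp : hyperbolic_group R S) (nonel : nonelementary Gam)
    (G : biInvCompleteGroupType R)
    (c : Gam -> boundary R S -> G)
    (tau : R) (tau_gt0 : 0 < tau) (tau_lt1 : tau < 1)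
    (c_holder : forall g : Gam, exists A : R, 0 < A /\
       forall xi eta : boundary R S,
         mdist (c g xi) (c g eta) <= A * powR_ereal tau (bprod xi eta))
    (c_cocycle : forall (g h : Gam) (omega : boundary R S),
       c (g * h)%g omega = (c g omega * c h (boundary_act g^-1%g omega))%g)
    (c_attracting : forall (g : Gam) (xi : boundary R S),
       infinite_order g -> attracting_point g xi -> c g xi = 1%g)
    (c_repelling : forall (g : Gam) (xi : boundary R S),
       infinite_order g -> repelling_point g xi -> c g xi = 1%g) :
  exists b : boundary R S -> G,
    [/\ continuous b,
        forall (g : Gam) (xi : boundary R S),
          c g xi = (b xi * (b (boundary_act g^-1%g xi))^-1)%g &
        exists A : R, 0 < A /\
          forall xi eta : boundary R S,
            mdist (b xi) (b eta) <= A * powR_ereal tau (bprod xi eta)].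
Proof.
have [delta hypd] := hyp.
have [eps [K [p ax]]] := axial_ex hypd nonel.
have [pp ppP] := axial_attracting_ex ax.
(* The repelling point of [p] is obtained as the attracting point of [p^-1], so that it too is moved
   by some group element. *)
have [pm pmP'] := axial_attracting_ex (axialV ax).
have pmP : repelling_point p pm.
  rewrite /repelling_point.
  by have <- : (fun n => p^-1 ^+ n)%g = (fun n => p ^- n)%g
    by apply/funext => n; rewrite expVgn.
have [g1 [r1 pm_moved]] := attracting_moved hypd nonel (axialV ax) pmP'.
have pp_moved := attracting_moved hypd nonel ax ppP.
have [b0 b0P] := backward_cocycle_cvg hypd ax ppP pmP tau_gt0 tau_lt1 c_holder c_cocycle
  c_attracting.
have [b bP] := b_exists hypd ax ppP pmP tau_gt0 tau_lt1 c_holder c_cocycle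
  c_attracting b0P pp_moved pm_moved.
exists b; split.
- exact: (b_continuous hypd ax pmP tau_gt0 tau_lt1 c_holder c_cocycle
    b0P pm_moved bP).
- exact: (b_cocycle hypd c_cocycle pm_moved bP).
- exact: (b_holder hypd ax pmP tau_gt0 tau_lt1 c_holder c_cocycle b0P pm_moved
    bP).
Qed.
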